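(* Any $m\in\mathbb{N}$ can be written as $x^2+y^2+z^2+w^2$ with $x,y,z,w\in\mathbb{N}/27$ such that $x+y+z$ is an integer square.
   Context: $\mathbb{N}=\{0,1,2,\ldots\}$; $\mathbb{N}/27=\{k/27: k\in\mathbb{N}\}$; an integer square is an element of $\{t^2: t\in\mathbb{Z}\}$. *)

(* Defs.v *)
From mathcomp Require Import all_boot all_order all_algebra.

Set Implicit Arguments.
Unset Strict Implicit.
Unset Printing Implicit Defensive.

Import GRing.Theory.
Local Open Scope ring_scope.

(* The set N/d; only meaningful for d > 0, since k / 0 = 0 in rat. *)
Definition in_nat_over (d : nat) (q : rat) : Prop :=
  exists k : nat, q = k%:R / d%:R.

Definition integer_square (q : rat) : Prop :=
  exists t : int, q = (t ^+ 2)%:~R.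

(* Main.v *)
Require Import Defs.
From Stdlib Require Import BinNat Nnat.
From mathcomp Require Import all_boot all_order all_algebra all_solvable all_field.
From mathcomp Require Import zify ring lra.

(** Put x = (s - A + B)/3, y = (s + A - C)/3, z = (s - B + C)/3 and
    w = (A + B + C)/3.  Then x + y + z = s and
      3 (x^2 + y^2 + z^2 + w^2) = s^2 + A^2 + B^2 + C^2,
    which is multiplicativity of the norm of quaternions for an element of norm
    3.  With s = t^2 it is therefore enough to write 3 m - t^4 as a sum of three
    squares A^2 + B^2 + C^2 with A - B, C - A, B - C at most t^2
    ([representable_three_squares]).  If t^4 <= 3 m <= 2 t^4, then A, B and C
    are at most t^2 and the inequalities hold by themselves
    ([representable_window]).  One may divide m by 16, doubling t; for m not
    divisible by 16 one of the two parities of t makes 3 m - t^4 a sum of three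
    squares by its residue modulo 16 ([three_squares_good_residue]), and once
    t >= 11 the windows of t and t + 2 overlap.  This settles m >= 6912, and below that bound a search over
    (t, A, B, C) settles all m but 3, 13 and 21, which use the denominator 27.

    It remains to prove the three-square theorem for n congruent to 1 or 2
    modulo 4 or to 3 modulo 8.  If K + 1 is a multiple of n and -n is a square
    modulo each prime dividing K to an odd power, then K = q v^2 with
    q | B^2 + n, and
      [[q, B, 0], [B, C, v], [0, v, w]],  C = (B^2 + n)/q,  w = (K + 1)/n,
    is positive definite of determinant 1.  By Hermite reduction it is the Gram
    matrix of three vectors of Z^3 ([ternary_unimodular_is_gram]), and
    n = q C - B^2 is the squared norm of the cross product of the first two.

    The usual source of K is Dirichlet's theorem on primes in progressions.  A
    weaker statement suffices: for a real character chi modulo M and a class c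
    with chi(c) = 1 there is k = c modulo M whose divisor sum
    f(k) = sum of chi(d) over d | k is positive
    ([positive_divisor_sum_in_class]).  Indeed f(k) > 0 forces primes with
    chi = -1 to have even exponents in k; with chi = (-n / .), a character
    modulo 8 N for N the odd part of n by quadratic reciprocity, that is the
    condition on K, and one takes K = k or K = 2 k.  The statement has an
    elementary proof.  As x tends to 1 from below, the difference of the sums of
    f(k) x^k over k = 1 and over k = c modulo M stays bounded, whereas the sum
    over k = 1 is unbounded because f >= 0 and f >= 1 on squares. *)

Set Implicit Arguments.
Unset Strict Implicit.
Unset Printing Implicit Defensive.

Import Order.TTheory GRing.Theory Num.Theory.
Local Open Scope ring_scope.

(** * Divisor sums of a real character *)

Definition real_character (M : nat) (chi : nat -> int) : Prop :=
  [/\ (1 < M)%N,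
      forall a, chi (a %% M)%N = chi a,
      forall a b, chi (a * b)%N = chi a * chi b
    & forall a, chi a ^+ 2 = (coprime a M)%:R].

Definition divisor_sum (chi : nat -> int) (k : nat) : int :=
  \sum_(d <- divisors k) chi d.

Lemma divisor_sum_mul (chi : nat -> int) (a b : nat) :
  (forall a b, chi (a * b)%N = chi a * chi b) ->
  (0 < a)%N -> (0 < b)%N -> coprime a b ->
  divisor_sum chi (a * b) = divisor_sum chi a * divisor_sum chi b.
Proof.
move=> chiM a0 b0 cab; rewrite /divisor_sum mulr_suml.
under [RHS]eq_bigr do rewrite mulr_sumr.
have -> : \sum_(i <- divisors (a * b)) chi i =
  \sum_(i <- [seq (x * y)%N | x <- divisors a, y <- divisors b]) chi i.
  apply: perm_big; apply: uniq_perm; first exact: divisors_uniq.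
    apply: allpairs_uniq; try exact: divisors_uniq.
    move=> [x y] [x' y'] /allpairsP[[u v] /= [+ + [-> ->]]].
    rewrite -!dvdn_divisors // => ua vb.
    move=> /allpairsP[[u' v'] /= [+ + [-> ->]]].
    rewrite -!dvdn_divisors // => ua' vb' e.
    have co (s t : nat) : (s %| a)%N -> (t %| b)%N -> coprime s t.
      by move=> sa tb; apply: coprime_dvdl sa _; apply: coprime_dvdr tb _.
    have uu : u = u'.
      apply/eqP; rewrite eqn_dvd; apply/andP; split.
        by rewrite -(@Gauss_dvdl _ _ v') ?co // -e dvdn_mulr.
      by rewrite -(@Gauss_dvdl _ _ v) ?co // e dvdn_mulr.
    move: e; rewrite -uu => /eqP; rewrite eqn_pmul2l ?(dvdn_gt0 a0) //.
    by move=> /eqP ->.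
  move=> d; rewrite -dvdn_divisors ?muln_gt0 ?a0 //; apply/idP/allpairsP.
    move=> dab; exists (gcdn d a, gcdn d b) => /=.
    rewrite -!dvdn_divisors // !dvdn_gcdr; split=> //.
    apply/eqP; rewrite eqn_dvd Gauss_dvd ?dvdn_gcdl ?andbT; last first.
      by apply: coprime_dvdl (dvdn_gcdr d a) _; apply: coprime_dvdr (dvdn_gcdr d b) _.
    have d0 : (0 < d)%N by apply: dvdn_gt0 dab; rewrite muln_gt0 a0.
    have g0 : (0 < gcdn d a)%N by rewrite gcdn_gt0 d0.
    have [d' dE] := dvdnP (dvdn_gcdl d a); have [a' aE] := dvdnP (dvdn_gcdr d a).
    have cda : coprime d' a'.
      rewrite /coprime -(eqn_pmul2r g0) mul1n muln_gcdl.
      by rewrite -dE -aE.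
    rewrite {1}dE mulnC dvdn_pmul2l // dvdn_gcd; apply/andP; split.
      by rewrite dE dvdn_mulr.
    rewrite -(Gauss_dvdr b cda) -(dvdn_pmul2r g0) -dE mulnAC -aE.
    exact: dab.
  move=> [[x y] /= []]; rewrite -!dvdn_divisors // => xa yb ->.
  exact: dvdn_mul.
rewrite big_allpairs_dep /=; apply: eq_bigr => i _; apply: eq_bigr => j _.
exact: chiM.
Qed.

Lemma divisor_sum_prime_power (chi : nat -> int) (p e : nat) :
  (forall a b, chi (a * b)%N = chi a * chi b) -> chi 1%N = 1 -> prime p ->
  divisor_sum chi (p ^ e) = \sum_(i < e.+1) chi p ^+ i.
Proof.
move=> chiM chi1 pp; rewrite /divisor_sum.
have -> : \sum_(d <- divisors (p ^ e)) chi d =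
    \sum_(d <- [seq (p ^ i)%N | i <- iota 0 e.+1]) chi d.
  apply: perm_big; apply: uniq_perm; first exact: divisors_uniq.
    rewrite map_inj_uniq ?iota_uniq // => i j /eqP.
    by rewrite eqn_exp2l ?prime_gt1 // => /eqP.
  move=> d; rewrite -dvdn_divisors ?expn_gt0 ?prime_gt0 //.
  apply/dvdn_pfactor/mapP => // -[i ie ->]; exists i => //.
    by rewrite mem_iota add0n ltnS.
  by move: ie; rewrite mem_iota add0n ltnS.
rewrite big_map -[iota 0 e.+1]/(index_iota 0 e.+1) big_mkord.
by apply: eq_bigr => i _; elim: (nat_of_ord i) => [|j IH]; rewrite ?expr0 // expnS chiM IH exprS.
Qed.

(** The local factor at p is the sum of chi(p)^i for i <= v, where v is the
    exponent of p.  It is at least 1, except that for chi(p) = -1 it is 1 or 0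
    according to the parity of v.  All three claims follow. *)
Lemma divisor_sum_spec (chi : nat -> int) (k : nat) :
  (forall a b, chi (a * b)%N = chi a * chi b) -> chi 1%N = 1 ->
  (forall a, chi a \in [:: 0; 1; -1]) -> (0 < k)%N ->
  [/\ 0 <= divisor_sum chi k,
      0 < divisor_sum chi k ->
        forall p, prime p -> chi p = -1 -> ~~ odd (logn p k)
    & (forall p, prime p -> ~~ odd (logn p k)) -> 1 <= divisor_sum chi k].
Proof.
move=> chiM chi1 chiV; elim/ltn_ind: k => k IH k0.
have [->|k1] := eqVneq k 1%N.
  rewrite /divisor_sum (_ : divisors 1 = [:: 1%N]) ?big_seq1 ?chi1 //; split=> // _ p pp _.
  by rewrite logn1.
have kgt1 : (1 < k)%N by rewrite ltn_neqAle eq_sym k1.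
set p := pdiv k; have pp : prime p := pdiv_prime kgt1.
have [k' ck' kE] := pfactor_coprime pp k0; set e := logn p k in kE.
have e0 : (0 < e)%N by rewrite logn_gt0 mem_primes pp k0 pdiv_dvd.
have k'0 : (0 < k')%N by move: k0; rewrite kE muln_gt0 => /andP[].
have k'k : (k' < k)%N.
  by rewrite kE ltn_Pmulr // -(exp1n e) ltn_exp2r // prime_gt1.
have pe0 : (0 < p ^ e)%N by rewrite expn_gt0 prime_gt0.
have [f0 fodd f1] := IH k' k'k k'0.
have fE : divisor_sum chi k = divisor_sum chi k' * \sum_(i < e.+1) chi p ^+ i.
  rewrite [in LHS]kE divisor_sum_mul ?divisor_sum_prime_power //.
  by rewrite coprimeXr // coprime_sym.
have lp : logn p k' = 0%N.
  by rewrite lognE pp k'0 /=; move: ck'; rewrite prime_coprime // => /negbTE ->.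
have lk r : prime r -> r != p -> logn r k = logn r k'.
  move=> pr rp; rewrite kE lognM // lognX (logn_prime r pp) (negbTE rp) muln0.
  by rewrite addn0.
have : [\/ \sum_(i < e.+1) chi p ^+ i >= 1 /\ chi p != -1
         | chi p = -1 /\ \sum_(i < e.+1) chi p ^+ i = (~~ odd e)%:R].
  have := chiV p; rewrite !inE => /or3P[] /eqP ->.
  - left; split=> //; rewrite big_ord_recl expr0 big1 ?addr0 // => i _.
    by rewrite expr0n.
  - left; split=> //; under eq_bigr do rewrite expr1n.
    by rewrite sumr_const card_ord ler1n.
  right; split=> //; elim: (e) => [|j IHj]; first by rewrite big_ord_recl big_ord0.
  by rewrite big_ord_recr IHj /= -signr_odd /=; case: (odd j).
case=> [[s1 chip]|[chip sE]]; split.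
- by rewrite fE mulr_ge0 // (le_trans _ s1).
- rewrite fE pmulr_lgt0 ?(lt_le_trans _ s1) // => /fodd H r pr cr.
  by rewrite lk ?H //; apply: contraNneq chip => <-; rewrite cr.
- move=> H; rewrite fE -[1]mulr1 ler_pM //; apply: f1 => r pr.
  have [->|rp] := eqVneq r p; first by rewrite lp.
  by rewrite -lk // H.
- by rewrite fE sE mulr_ge0.
- rewrite fE sE => H r pr cr; move: H.
  case: (boolP (odd e)) => oe; first by rewrite mulr0 ltxx.
  rewrite mulr1 => /fodd H.
  by have [->|rp] := eqVneq r p; rewrite // lk // H.
- move=> H; rewrite fE sE (H p pp) mulr1; apply: f1 => r pr.
  have [->|rp] := eqVneq r p; first by rewrite lp.
  by rewrite -lk // H.
Qed.

(** * Elementary estimates over the rationals *)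

Lemma expr_Lipschitz (y z : rat) n : 0 <= z -> z <= y -> y <= 1 ->
  `|y ^+ n - z ^+ n| <= n%:R * (y - z).
Proof.
move=> z0 zy y1; have y0 := le_trans z0 zy; have z1 := le_trans zy y1.
elim: n => [|n IH]; first by rewrite !expr0 subrr normr0 mul0r.
have -> : y ^+ n.+1 - z ^+ n.+1 = y * (y ^+ n - z ^+ n) + (y - z) * z ^+ n.
  by rewrite !exprS; ring.
apply: le_trans (ler_normD _ _) _; rewrite -[n.+1%:R]natr1 [(_ + 1) * _]mulrDl mul1r !normrM.
rewrite (ger0_norm y0) (ger0_norm (_ : 0 <= y - z)) ?subr_ge0 //.
rewrite lerD //; first by apply: le_trans IH; rewrite ler_piMl.
by rewrite ler_piMr ?subr_ge0 // ger0_norm ?exprn_ge0 // exprn_ile1.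
Qed.

Lemma geom_norm (y : rat) n : 0 <= y -> y <= 1 -> `|\sum_(i < n) y ^+ i| <= n%:R.
Proof.
move=> y0 y1; apply: le_trans (ler_norm_sum _ _ _) _.
rewrite -[X in _ <= X%:R](card_ord n) -sumr_const; apply: ler_sum => i _.
by rewrite ger0_norm ?exprn_ge0 // exprn_ile1.
Qed.

Lemma geom_Lipschitz (y z : rat) n : 0 <= z -> z <= y -> y <= 1 ->
  `|\sum_(i < n) y ^+ i - \sum_(i < n) z ^+ i| <= (n ^ 2)%:R * (y - z).
Proof.
move=> z0 zy y1; rewrite -sumrB; apply: le_trans (ler_norm_sum _ _ _) _.
apply: (@le_trans _ _ (\sum_(i < n) n%:R * (y - z))).
  apply: ler_sum => i _; apply: le_trans (expr_Lipschitz _ z0 zy y1) _.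
  by rewrite ler_wpM2r ?subr_ge0 // ler_nat ltnW.
by rewrite sumr_const card_ord -[_ *+ n]mulr_natl mulrA -natrM.
Qed.

Lemma Bernoulli_ineq (u : rat) n : -1 <= u -> 1 + n%:R * u <= (1 + u) ^+ n.
Proof.
move=> u1; elim: n => [|n IH]; first by rewrite mul0r addr0 expr0.
rewrite exprS; apply: le_trans (_ : (1 + u) * (1 + n%:R * u) <= _); last first.
  by apply: ler_wpM2l => //; lra.
have -> : (1 + u) * (1 + n%:R * u) = 1 + n.+1%:R * u + n%:R * (u * u).
  by rewrite -[n.+1%:R]natr1; ring.
by rewrite lerDl mulr_ge0 // -expr2 sqr_ge0.
Qed.

(** (1 - 1/T)^T <= 1/2, since (1 - 1/T)(1 + 1/T) <= 1 and (1 + 1/T)^T >= 2. *)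
Lemma power_decay (T n : nat) : (1 < T)%N ->
  (1 - T%:R^-1 : rat) ^+ (T * n) <= (2 ^ n)%:R^-1.
Proof.
move=> T1; have T0 : 0 < T%:R :> rat by rewrite ltr0n ltnW.
have Ti : T%:R^-1 <= 1 :> rat by rewrite invf_le1 // ler1n ltnW.
have Ti0 : 0 < T%:R^-1 :> rat by rewrite invr_gt0.
have x0 : 0 <= 1 - T%:R^-1 :> rat by rewrite subr_ge0.
rewrite exprM natrX -exprVn lerXn2r ?nnegrE ?exprn_ge0 ?invr_ge0 //.
rewrite -[leRHS]mul1r ler_pdivlMr //.
apply: le_trans (_ : (1 - T%:R^-1 : rat) ^+ T * (1 + T%:R^-1) ^+ T <= _).
  apply: ler_wpM2l; first exact: exprn_ge0.
  apply: le_trans (Bernoulli_ineq T _); last by lra.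
  by rewrite divff ?gt_eqF.
rewrite -exprMn exprn_ile1 //.
  by rewrite mulr_ge0 // addr_ge0 // ltW.
have -> : (1 - T%:R^-1) * (1 + T%:R^-1) = 1 - T%:R^-1 * T%:R^-1 :> rat by ring.
by rewrite gerBl mulr_ge0 // ltW.
Qed.

Lemma sum_multiples (R : nmodType) N a (g : nat -> R) : (0 < a)%N ->
  \sum_(b < N | (a * b < N)%N) g (a * b)%N = \sum_(k < N | (a %| k)%N) g k.
Proof.
move=> a0.
transitivity (\sum_(b < N) \sum_(k < N | k == (a * b)%N :> nat) g k).
  rewrite big_mkcond; apply: eq_bigr => b _.
  case: ltnP => h.
    rewrite (bigD1 (Ordinal h)) //= big1 ?addr0 // => k /andP[/eqP k1].
    by rewrite -(inj_eq val_inj) /= k1 eqxx.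
  rewrite big1 // => k /eqP kE; move: (ltn_ord k); rewrite kE ltnNge h.
  by [].
rewrite (exchange_big_dep (fun k : 'I_N => (a %| k)%N)) /=; last first.
  by move=> b k _ /eqP ->; rewrite dvdn_mulr.
apply: eq_bigr => k /dvdnP[q kE].
have qN : (q < N)%N.
  by apply: leq_ltn_trans (ltn_ord k); rewrite kE leq_pmulr.
rewrite (bigD1 (Ordinal qN)) /= ?kE 1?mulnC //=.
rewrite big1 ?addr0 // => b /andP[/eqP kb /negP[]].
rewrite -(inj_eq val_inj) /= -(eqn_pmul2l a0). by rewrite -kb mulnC.
Qed.

(** * A residue class where the divisor sum is positive *)

Definition class_diff (M c k : nat) : rat :=
  (k == 1 %[mod M])%:R - (k == c %[mod M])%:R.

Lemma sum_residue_mul (M c b : nat) : (0 < M)%N -> coprime c M -> coprime b M ->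
  \sum_(a < M) (a * b == c %[mod M])%:R = 1 :> rat.
Proof.
move=> M0 cc cb.
pose h (i : 'I_M) : 'I_M := Ordinal (ltn_pmod (i * b) M0).
have hinj : injective h.
  have aux (i j : 'I_M) : (i <= j)%N -> h i = h j -> i = j.
    move=> ij /(congr1 val) /= /eqP; rewrite eq_sym eqn_mod_dvd ?leq_mul2r ?ij ?orbT //.
    rewrite -mulnBl Gauss_dvdl 1?coprime_sym // => d.
    apply/val_inj/eqP; rewrite eqn_leq ij /= -subn_eq0.
    by apply: contraTT d; rewrite -lt0n => ?; rewrite gtnNdvd // (leq_ltn_trans (leq_subr _ _)).
  by move=> i j e; case: (leqP i j) => [|/ltnW] ij; [|symmetry]; apply: aux.
rewrite (eq_bigr (fun i => (h i == Ordinal (ltn_pmod c M0))%:R)); last first.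
  by move=> i _; rewrite -(inj_eq val_inj).
rewrite -(reindex_inj hinj (P := xpredT) (F := fun i => (i == Ordinal (ltn_pmod c M0))%:R)) /=.
by rewrite (bigD1 (Ordinal (ltn_pmod c M0))) //= eqxx big1 ?addr0 // => i /negbTE ->.
Qed.

Section CharacterSums.
Variables (M c : nat) (chi : nat -> int).
Hypotheses (chiP : real_character M chi) (cM : coprime c M) (chic : chi c = 1).

Let M1 : (1 < M)%N. Proof. by case: chiP. Qed.
Let M0 : (0 < M)%N. Proof. exact: ltnW. Qed.
Let chi_mod a : chi (a %% M)%N = chi a. Proof. by case: chiP. Qed.
Let chiM a b : chi (a * b)%N = chi a * chi b. Proof. by case: chiP. Qed.
Let chi_sq a : chi a ^+ 2 = (coprime a M)%:R. Proof. by case: chiP. Qed.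

Lemma real_character_values a : chi a \in [:: 0; 1; -1].
Proof.
rewrite !inE -(sqrf_eq0 (chi a)) -sqrf_eq1 chi_sq.
by case: coprime.
Qed.

Lemma real_character1 : chi 1%N = 1.
Proof.
have := chiM 1 1; have := chi_sq 1; rewrite coprime1n expr2 => ->.
by [].
Qed.

Let e := class_diff M c.

Lemma class_diff0 : e 0 = 0.
Proof.
have H b : coprime b M -> (0 == b %[mod M]) = false.
  move=> cb; apply/negP; rewrite mod0n eq_sym => /eqP/eqP db.
  move: cb; rewrite coprime_sym /coprime => /eqP.
  by rewrite (gcdn_idPl _) // => M1'; move: M1; rewrite M1'.
by rewrite /e /class_diff !H ?coprime1n // subrr.
Qed.

Lemma class_diff_mod a b : e (a %% M * b) = e (a * b).
Proof. by rewrite /e /class_diff !modnMml. Qed.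

Lemma class_diff_norm k : `|e k| <= 1.
Proof.
rewrite /e /class_diff; case: (_ == _ %[mod _]); case: (_ == _ %[mod _]) => /=.
all: by rewrite ?subrr ?subr0 ?sub0r ?normrN ?normr0 ?normr1.
Qed.

Lemma coprime_mul_class a b d : coprime d M -> (a * b == d %[mod M]) -> coprime b M.
Proof.
move=> cd /eqP h.
have : coprime (a * b) M by rewrite -coprime_modl h coprime_modl.
by rewrite coprimeMl => /andP[].
Qed.

(** Where e(a b) is nonzero, a b is 1 or c modulo M, and chi is 1 at both; so
    chi(a) chi(b) = 1. *)
Lemma character_class_diff a b : (chi a)%:~R * e (a * b) = (chi b)%:~R * e (a * b).
Proof.
have H d : chi d = 1 -> coprime d M ->
    (chi a)%:~R * (a * b == d %[mod M])%:R = (chi b)%:~R * (a * b == d %[mod M])%:R :> rat.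
  move=> chid cd; case: (boolP (_ == _)) => [h|_]; last by rewrite !mulr0.
  have cb := coprime_mul_class cd h.
  have chiab : chi a * chi b = 1.
    by rewrite -chiM -chi_mod (eqP h) chi_mod.
  have : chi b ^+ 2 = 1 by rewrite chi_sq cb.
  rewrite expr2 => b2; congr (_%:~R * _).
  by rewrite -[chi a]mulr1 -b2 mulrA chiab mul1r.
by rewrite /e /class_diff !mulrBr !H ?coprime1n ?real_character1.
Qed.

Lemma sum_class_diff b : \sum_(a < M) e (a * b) = 0.
Proof.
rewrite /e /class_diff sumrB.
case: (boolP (coprime b M)) => cb; first by rewrite !sum_residue_mul ?coprime1n ?subrr.
rewrite !big1 ?subr0 // => a _.
  by case: (boolP (_ == _)) cb => // /(coprime_mul_class cM) ->.
by case: (boolP (_ == _)) cb => // /(coprime_mul_class (coprime1n M)) ->.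
Qed.

Lemma sum_class_diff_r a : \sum_(b < M) e (a * b) = 0.
Proof. by rewrite -[RHS](sum_class_diff a); apply: eq_bigr => b _; rewrite mulnC. Qed.

Lemma sum_character_class_diff b : \sum_(a < M) (chi a)%:~R * e (a * b) = 0.
Proof.
under eq_bigr do rewrite character_class_diff.
by rewrite -mulr_sumr sum_class_diff mulr0.
Qed.

(** For fixed a, the sum of e(a b) y^b over b < J M is the polynomial
    E(y), the sum of e(a b) y^b over b < M, times
    (y^(J M) - 1) / (y^M - 1).  Since E(1) = 0, both E(y) and y^M - 1 are
    divisible by y - 1; the quotients are [class_num] and [class_den].  Their
    ratio is Lipschitz on [0, 1] because the denominator is at least 1 there. *)
Definition class_num a (y : rat) := \sum_(b < M) e (a * b) * \sum_(i < b) y ^+ i.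
Definition class_den (y : rat) := \sum_(i < M) y ^+ i.
Definition class_kernel N a y := class_num a y / class_den y * (y ^+ N - 1).

Lemma class_num_norm a y : 0 <= y -> y <= 1 -> `|class_num a y| <= (M ^ 2)%:R.
Proof.
move=> y0 y1; apply: le_trans (ler_norm_sum _ _ _) _.
apply: (@le_trans _ _ (\sum_(b < M) M%:R)).
  apply: ler_sum => b _; rewrite normrM -[M%:R]mul1r ler_pM ?normr_ge0 ?class_diff_norm //.
  by apply: le_trans (geom_norm _ y0 y1) _; rewrite ler_nat ltnW.
by rewrite sumr_const card_ord -[_ *+ M]mulr_natl -natrM.
Qed.

Lemma class_num_Lipschitz a y z : 0 <= z -> z <= y -> y <= 1 ->
  `|class_num a y - class_num a z| <= (M ^ 3)%:R * (y - z).
Proof.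
move=> z0 zy y1; rewrite -sumrB; apply: le_trans (ler_norm_sum _ _ _) _.
apply: (@le_trans _ _ (\sum_(b < M) (M ^ 2)%:R * (y - z))).
  apply: ler_sum => b _; rewrite -mulrBr normrM -[X in _ <= X]mul1r.
  rewrite ler_pM ?normr_ge0 ?class_diff_norm //.
  apply: le_trans (geom_Lipschitz _ z0 zy y1) _.
  by rewrite ler_wpM2r ?subr_ge0 // ler_nat leq_exp2r // ltnW.
by rewrite sumr_const card_ord -[_ *+ M]mulr_natl mulrA -natrM -expnS.
Qed.

Lemma class_den_ge1 y : 0 <= y -> 1 <= class_den y.
Proof.
move=> y0; rewrite /class_den -(prednK M0) big_ord_recl expr0 lerDl.
by apply: sumr_ge0 => i _; rewrite exprn_ge0.
Qed.

Lemma class_ratio_norm a y : 0 <= y -> y <= 1 -> `|class_num a y / class_den y| <= (M ^ 2)%:R.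
Proof.
move=> y0 y1; have q1 := class_den_ge1 y0; have q0 : 0 < class_den y by apply: lt_le_trans q1.
rewrite normrM normfV (gtr0_norm q0) ler_pdivrMr //.
by apply: le_trans (class_num_norm a y0 y1) _; rewrite ler_peMr.
Qed.

Lemma class_ratio_Lipschitz a y z : 0 <= z -> z <= y -> y <= 1 ->
  `|class_num a y / class_den y - class_num a z / class_den z| <= (2 * M ^ 4)%:R * (y - z).
Proof.
move=> z0 zy y1; have y0 := le_trans z0 zy; have z1 := le_trans zy y1.
have qy := class_den_ge1 y0; have qz := class_den_ge1 z0.
have qy0 : 0 < class_den y by apply: lt_le_trans qy.
have qz0 : 0 < class_den z by apply: lt_le_trans qz.
have -> : class_num a y / class_den y - class_num a z / class_den z =
    ((class_num a y - class_num a z) -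
      class_num a z / class_den z * (class_den y - class_den z)) / class_den y.
  by field; rewrite !gt_eqF.
rewrite normrM normfV (gtr0_norm qy0) ler_pdivrMr //.
apply: le_trans (_ : (2 * M ^ 4)%:R * (y - z) <= _); last first.
  by rewrite ler_peMr // mulr_ge0 ?subr_ge0.
rewrite mul2n -addnn natrD mulrDl.
apply: le_trans (ler_normB _ _) _; apply: lerD.
  apply: le_trans (class_num_Lipschitz a z0 zy y1) _.
  by rewrite ler_wpM2r ?subr_ge0 // ler_nat leq_exp2l.
have -> : (M ^ 4 = M ^ 2 * M ^ 2)%N by rewrite -expnD.
rewrite normrM natrM -mulrA ler_pM ?normr_ge0 ?class_ratio_norm //.
exact: geom_Lipschitz.
Qed.

(** Both terms on the right telescope along a decreasing sequence of points, so
    the total variation on [0, 1] is bounded independently of N. *)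
Lemma class_kernel_variation N a y z : 0 <= z -> z <= y -> y <= 1 ->
  `|class_kernel N a y - class_kernel N a z| <=
    (2 * M ^ 4)%:R * (y - z) + (M ^ 2)%:R * (y ^+ N - z ^+ N).
Proof.
move=> z0 zy y1; have y0 := le_trans z0 zy; have z1 := le_trans zy y1.
have -> : class_kernel N a y - class_kernel N a z =
  (class_num a y / class_den y - class_num a z / class_den z) * (y ^+ N - 1) +
  class_num a z / class_den z * (y ^+ N - z ^+ N) by rewrite /class_kernel; ring.
have yN : 0 <= y ^+ N <= 1 by rewrite exprn_ge0 // exprn_ile1.
have zyN : z ^+ N <= y ^+ N by rewrite lerXn2r ?nnegrE.
apply: le_trans (ler_normD _ _) _; apply: lerD.
  rewrite normrM -[X in _ <= X]mulr1 ler_pM ?normr_ge0 ?class_ratio_Lipschitz // ler_norml.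
  by case/andP: yN => ? ?; apply/andP; split; lra.
rewrite normrM (ger0_norm (_ : 0 <= y ^+ N - z ^+ N)) ?subr_ge0 //.
by rewrite ler_wpM2r ?subr_ge0 // class_ratio_norm.
Qed.

Lemma class_kernelE J a y : 0 <= y -> y != 1 ->
  \sum_(b < J * M) e (a * b) * y ^+ b = class_kernel (J * M) a y.
Proof.
move=> y0 y1; have y10 : y - 1 != 0 by rewrite subr_eq0.
have E1 : \sum_(b < M) e (a * b) * y ^+ b = (y - 1) * class_num a y.
  rewrite /class_num mulr_sumr.
  transitivity (\sum_(b < M) e (a * b) * y ^+ b - \sum_(b < M) e (a * b)).
    by rewrite sum_class_diff_r subr0.
  rewrite -sumrB; apply: eq_bigr => b _.
  by rewrite -[X in _ - X]mulr1 -mulrBr subrX1; ring.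
have E2 : \sum_(b < J * M) e (a * b) * y ^+ b =
    (\sum_(b < M) e (a * b) * y ^+ b) * \sum_(j < J) (y ^+ M) ^+ j.
  rewrite -(big_mkord xpredT (fun b => e (a * b) * y ^+ b)) big_nat_mul mulr_sumr big_mkord.
  apply: eq_bigr => j _; rewrite -[(j * M)%N]add0n big_addn mulSn addnK.
  rewrite big_mkord mulr_suml; apply: eq_bigr => b _.
  rewrite -exprM exprD -[e (a * _)]class_diff_mod.
  rewrite /e /class_diff !modnMml.
  have -> : (a * (b + j * M) = a * b %[mod M])%N.
    by rewrite mulnDr mulnA -[(_ + _)%N]addnC modnMDl.
  by rewrite [(M * j)%N]mulnC mulrA.
have E3 : y ^+ (J * M) - 1 = (y - 1) * class_den y * \sum_(j < J) (y ^+ M) ^+ j.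
  by rewrite mulnC exprM subrX1 subrX1.
rewrite E2 E1 /class_kernel E3; field.
by rewrite gt_eqF // (lt_le_trans _ (class_den_ge1 y0)).
Qed.

(** Grouping by a gives [lambert_sum_bounded], grouping by k = a b gives the
    divisor sums. *)
Definition lambert_sum N (x : rat) :=
  \sum_(a < N) \sum_(b < N) (chi a)%:~R * e (a * b) * x ^+ (a * b).

Lemma character0 : chi 0%N = 0.
Proof. by apply/eqP; rewrite -sqrf_eq0 chi_sq /coprime gcd0n gtn_eqF. Qed.

(** The inner sum for a is the kernel of the class of a at x^a.  If all a of a
    block of length M were evaluated at the same point, the block would cancel
    because chi(a) e(a b) sums to 0 over a.  The actual points x^a of a block
    cost only the variation of the kernels over an interval, and the intervals
    of different blocks do not overlap. *)
Lemma lambert_sum_bounded J x : 0 <= x -> x < 1 ->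
  `|lambert_sum (J * M) x| <= (M * (2 * M ^ 4 + M ^ 2))%:R.
Proof.
move=> x0 x1; set N := (J * M)%N.
have xle i : x ^+ i <= 1 by rewrite exprn_ile1 // ltW.
have xge i : 0 <= x ^+ i by rewrite exprn_ge0.
have -> : lambert_sum N x = \sum_(0 <= a < N) (chi a)%:~R * class_kernel N a (x ^+ a).
  rewrite big_mkord; apply: eq_bigr => -[[|a] aN] _ /=.
    by rewrite big1 ?character0 ?mul0r // => b _; rewrite !mul0r.
  rewrite -class_kernelE //; last by rewrite lt_eqF // exprn_ilt1.
  by rewrite mulr_sumr; apply: eq_bigr => b _; rewrite -mulrA exprM.
have Hmod j a y : class_kernel N (a + j * M) y = class_kernel N a y.
  rewrite /class_kernel /class_num; congr (_ / _ * _); apply: eq_bigr => b _.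
  by rewrite -class_diff_mod addnC modnMDl class_diff_mod.
pose w j := (2 * M ^ 4)%:R * x ^+ (j * M) + (M ^ 2)%:R * (x ^+ (j * M)) ^+ N.
rewrite big_nat_mul big_mkord; apply: le_trans (ler_norm_sum _ _ _) _.
have bound (j : 'I_J) :
    `|\sum_(j * M <= a < j.+1 * M) (chi a)%:~R * class_kernel N a (x ^+ a)| <=
    M%:R * (w j - w j.+1).
  rewrite -[(j * M)%N]add0n big_addn mulSn addnK big_mkord.
  have -> : \sum_(a < M) (chi (a + j * M)%N)%:~R * class_kernel N (a + j * M) (x ^+ (a + j * M)) =
    \sum_(a < M) (chi a)%:~R *
      (class_kernel N a (x ^+ (a + j * M)) - class_kernel N a (x ^+ (j * M))).
    under [RHS]eq_bigr do rewrite mulrBr.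
    rewrite sumrB [X in _ - X](_ : _ = 0) ?subr0; last first.
      rewrite /class_kernel; under eq_bigr do rewrite mulrA mulrA.
      rewrite -!mulr_suml /class_num; under eq_bigr do rewrite mulr_sumr.
      rewrite exchange_big big1 ?mul0r // => b _.
      under eq_bigr do rewrite mulrA.
      by rewrite -mulr_suml sum_character_class_diff mul0r.
    by apply: eq_bigr => a _; rewrite Hmod -chi_mod addnC modnMDl chi_mod.
  apply: le_trans (ler_norm_sum _ _ _) _.
  rewrite mulr_natl -[X in _ *+ X](card_ord M) -sumr_const; apply: ler_sum => a _.
  rewrite normrM -[X in _ <= X]mul1r ler_pM ?normr_ge0 //.
    have := real_character_values a; rewrite !inE => /or3P[] /eqP ->.
    - by rewrite normr0.
    - by rewrite normr1.
    - by rewrite mulrN1z normrN normr1.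
  have xx : x ^+ (j.+1 * M) <= x ^+ (a + j * M).
    apply: ler_wiXn2l => //; first exact: ltW.
    by rewrite mulSn leq_add2r ltnW.
  have xx' : x ^+ (a + j * M) <= x ^+ (j * M).
    apply: ler_wiXn2l => //; first exact: ltW.
    by rewrite leq_addl.
  rewrite distrC; apply: le_trans (class_kernel_variation N a (xge _) xx' (xle _)) _.
  rewrite /w opprD addrACA -!mulrBr; apply: lerD; apply: ler_wpM2l => //.
    by rewrite lerB.
  by rewrite lerB // lerXn2r ?nnegrE.
apply: le_trans (ler_sum _ (fun j _ => bound j)) _.
rewrite -mulr_sumr natrM; apply: ler_wpM2l => //.
rewrite -(big_mkord xpredT (fun j => w j - w j.+1)).
rewrite (eq_bigr (fun j => - (w j.+1 - w j))); last by move=> j _; rewrite opprB.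
rewrite sumrN telescope_sumr // opprB {1}/w mul0n expr0 expr1n !mulr1 -natrD.
by rewrite gerBl addr_ge0 // mulr_ge0 // exprn_ge0.
Qed.

Lemma sum_divisors_ord N k : (0 < k < N)%N ->
  \sum_(a < N | (a %| k)%N) chi a = divisor_sum chi k.
Proof.
move=> /andP[k0 kN]; rewrite /divisor_sum -(big_mkord (fun a => a %| k)%N) -big_filter.
apply: perm_big; apply: uniq_perm; rewrite ?divisors_uniq ?filter_uniq ?iota_uniq //.
move=> d; rewrite mem_filter mem_index_iota /= -dvdn_divisors //.
case: (boolP (d %| k)%N) => //= dk.
by rewrite (leq_ltn_trans (dvdn_leq k0 dk)).
Qed.

(** The pairs with a b < N give exactly the divisor sums; each of the at most
    N^2 other pairs contributes at most x^N. *)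
Lemma lambert_sum_divisor N x : 0 <= x -> x <= 1 ->
  `|lambert_sum N x - \sum_(k < N) (divisor_sum chi k)%:~R * e k * x ^+ k| <=
  (N ^ 2)%:R * x ^+ N.
Proof.
move=> x0 x1.
pose F a b := (chi a)%:~R * e (a * b) * x ^+ (a * b).
have -> : lambert_sum N x = \sum_(a < N) \sum_(b < N | (a * b < N)%N) F a b
   + \sum_(a < N) \sum_(b < N | ~~ (a * b < N)%N) F a b.
  by rewrite -big_split; apply: eq_bigr => a _; rewrite (bigID (fun b : 'I_N => (a * b < N)%N)).
have -> : \sum_(a < N) \sum_(b < N | (a * b < N)%N) F a b =
          \sum_(k < N) (divisor_sum chi k)%:~R * e k * x ^+ k.
  transitivity (\sum_(a < N) \sum_(k < N | (a %| k)%N) (chi a)%:~R * (e k * x ^+ k)).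
    apply: eq_bigr => -[[|a] aN] _.
      have c0 y : (chi 0%N)%:~R * y = 0 :> rat by rewrite character0 mul0r.
      rewrite /F /= [LHS]big1 => [|b _]; last by rewrite -mulrA c0.
      by rewrite big1 // => k _; rewrite c0.
    rewrite -mulr_sumr -(@sum_multiples _ N a.+1 (fun k => e k * x ^+ k)) //.
    by rewrite mulr_sumr; apply: eq_bigr => b _; rewrite mulrA.
  rewrite (exchange_big_dep xpredT) //=; apply: eq_bigr => -[[|k] kN] _ /=.
    by rewrite class_diff0 mulr0 mul0r big1 // => a _; rewrite mulr0.
  rewrite -mulr_suml -mulrA; congr (_ * _).
  rewrite -(sum_divisors_ord (N := N)) // rmorph_sum.
  by [].
rewrite addrAC subrr add0r; apply: le_trans (ler_norm_sum _ _ _) _.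
have -> : (N ^ 2)%:R * x ^+ N = \sum_(a < N) \sum_(b < N) x ^+ N.
  by rewrite !sumr_const !card_ord -mulrnA mulr_natl.
apply: ler_sum => a _; apply: le_trans (ler_norm_sum _ _ _) _.
rewrite big_mkcond; apply: ler_sum => b _.
case: ltnP => h; first by rewrite exprn_ge0.
rewrite /F !normrM -[x ^+ N]mul1r (ger0_norm (exprn_ge0 _ x0)).
apply: ler_pM; rewrite ?mulr_ge0 ?normr_ge0 ?exprn_ge0 //; last exact: ler_wiXn2l.
rewrite -[1]mulr1 ler_pM ?normr_ge0 ?class_diff_norm //.
have := real_character_values a; rewrite !inE => /or3P[] /eqP ->.
- by rewrite normr0.
- by rewrite normr1.
- by rewrite mulrN1z normrN normr1.
Qed.

Lemma sum_squares_le (I N : nat) (x : rat) (f : nat -> rat) :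
  0 <= x -> ((1 + I * M) ^ 2 <= N)%N ->
  (forall k, (k < N)%N -> 0 <= f k) ->
  (forall i, (i < I)%N -> 1 <= f ((1 + i * M) ^ 2)%N) ->
  \sum_(i < I) x ^+ ((1 + i * M) ^ 2) <= \sum_(k < N) f k * x ^+ k.
Proof.
move=> x0 IN f0 f1.
have lt (i : 'I_I) : ((1 + i * M) ^ 2 < N)%N.
  apply: leq_trans IN; rewrite ltn_exp2r // ltn_add2l ltn_mul2r M0.
  exact: ltn_ord.
pose h (i : 'I_I) : 'I_N := Ordinal (lt i).
have hinj : injective h.
  move=> i j /(congr1 val) /= /eqP; rewrite eqn_exp2r // eqn_add2l eqn_mul2r.
  by rewrite gtn_eqF //= => /eqP /val_inj.
pose A := [set h i | i in 'I_I]; rewrite [leRHS](bigID (fun k => k \in A)) /=.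
apply: le_trans (_ : \sum_(k in A) f k * x ^+ k <= _); last first.
  by rewrite lerDl sumr_ge0 // => k _; rewrite mulr_ge0 ?f0 ?exprn_ge0.
rewrite big_imset /=; last by move=> i j _ _; exact: hinj.
by apply: ler_sum => i _; rewrite ler_peMl ?exprn_ge0 ?f1.
Qed.

(** If c = 1, then k = 1 will do.  Otherwise suppose that f vanishes on the class
    of c, for the k below a suitable N.  Then only k = 1 modulo M contributes to
    the sum of f(k) e(k) x^k, so this sum is at least the sum of x^(j^2) over
    the j = 1 modulo M, which exceeds any bound for x close to 1. *)
Theorem positive_divisor_sum_in_class :
  exists k, [/\ (0 < k)%N, k = c %[mod M] & 0 < divisor_sum chi k].
Proof.
have f1 : divisor_sum chi 1 = 1.
  by rewrite /divisor_sum (_ : divisors 1 = [:: 1%N]) // big_seq1 real_character1.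
have [c1|c1] := eqVneq (1 %% M)%N (c %% M)%N; first by exists 1%N; rewrite f1.
have spec k k0 := divisor_sum_spec (k := k) chiM real_character1 real_character_values k0.
(* K bounds the Lambert sums, and K + 1 allows for the tail.  The choice of T
   makes each of the first I squares contribute at least 1/2, and I / 2 exceeds
   K + 1; N is a multiple of M large enough for N^2 x^N <= 1. *)
pose K := (M * (2 * M ^ 4 + M ^ 2))%N; pose I := (2 * K + 3)%N.
pose T := (2 * (1 + I * M) ^ 2)%N; pose R := (T * M)%N; pose N := (T * (4 * R) * M)%N.
pose x : rat := 1 - T%:R^-1.
have T1 : (1 < T)%N by rewrite /T -{1}[2%N]muln1 leq_mul2l /= expn_gt0.
have R1 : (0 < R)%N by rewrite muln_gt0 M0 ltnW.
have T0 : 0 < T%:R :> rat by rewrite ltr0n ltnW.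
have x0 : 0 <= x by rewrite subr_ge0 invf_le1 // ler1n ltnW.
have x1 : x < 1 by rewrite gtrBl invr_gt0.
have [/existsP[k /and3P[k0 /eqP kc fk]]|no] :=
  boolP [exists k : 'I_N, [&& (0 < k)%N, k == c %[mod M] & 0 < divisor_sum chi k]].
  by exists k.
have nonpos k : (k < N)%N -> (0 < k)%N -> k == c %[mod M] -> divisor_sum chi k = 0.
  move=> kN k0 kc; have [f0 _ _] := spec k k0; apply/eqP.
  rewrite eq_le f0 andbT leNgt.
  by apply: contra no => fk; apply/existsP; exists (Ordinal kN); rewrite /= k0 kc.
have low : \sum_(i < I) x ^+ ((1 + i * M) ^ 2) <=
           \sum_(k < N) ((divisor_sum chi k)%:~R * e k) * x ^+ k.
  apply: (@sum_squares_le I N x (fun k => (divisor_sum chi k)%:~R * e k)) => //.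
  - have -> : N = ((1 + I * M) ^ 2 * (2 * (4 * R) * M))%N by rewrite /N /T; ring.
    by apply: leq_pmulr; rewrite (muln_gt0 (2 * (4 * R))) M0 andbT mulnA muln_gt0 R1.
  - move=> k kN; case: (posnP k) => [->|k0]; first by rewrite class_diff0 mulr0.
    rewrite /e /class_diff; have [kc|_] := boolP (k == c %[mod M]).
      by rewrite nonpos // mul0r.
    by rewrite subr0 mulr_ge0 // ler0z; have [] := spec k k0.
  move=> i iI; set k := ((1 + i * M) ^ 2)%N.
  have k0 : (0 < k)%N by rewrite expn_gt0.
  have k1 : (k = 1 %[mod M])%N.
    by rewrite /k expnS expn1 -modnMml -modnMmr addnC !modnMDl modnMml modnMmr muln1.
  rewrite /e /class_diff k1 eqxx (negbTE c1) subr0 mulr1 ler1z.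
  have [_ _ ->] := spec k k0 => // p pp.
  by rewrite /k lognX oddM.
have up : \sum_(k < N) ((divisor_sum chi k)%:~R * e k) * x ^+ k <= K%:R + 1.
  have := lambert_sum_divisor N x0 (ltW x1).
  have := lambert_sum_bounded (T * (4 * R)) x0 x1; rewrite -/N -/K.
  have tail : (N ^ 2)%:R * x ^+ N <= 1.
    have -> : (N = T * (4 * R * M))%N by rewrite /N [in RHS]mulnA.
    apply: le_trans (ler_wpM2l _ (power_decay _ T1)) _ => //.
    rewrite ler_pdivrMr ?ltr0n ?expn_gt0 // mul1r ler_nat.
    apply: leq_trans (_ : (2 ^ R) ^ 4 <= _)%N; last first.
      by rewrite -expnM leq_exp2l // mulnC leq_pmulr.
    have -> : (T * (4 * R * M) = (2 * R) ^ 2)%N by rewrite /R; ring.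
    rewrite -expnM.
    rewrite leq_exp2r //; case: (R) R1 => // r _.
    by rewrite expnS leq_mul2l /= ltn_expl.
  rewrite !ler_norml => /andP[_ h1] /andP[h2 _].
  by move: tail h1 h2; set S := lambert_sum _ _; set D := \sum_(k < N) _; lra.
have big : I%:R / 2 <= \sum_(i < I) x ^+ ((1 + i * M) ^ 2).
  rewrite mulr_natl -[X in _ *+ X](card_ord I) -sumr_const; apply: ler_sum => i _.
  apply: le_trans (Bernoulli_ineq _ _); last first.
    by rewrite lerN2 invf_le1 // ler1n ltnW.
  have : (((1 + i * M) ^ 2)%:R / T%:R : rat) <= 2^-1; last by lra.
  rewrite ler_pdivrMr // /T natrM mulKf // ler_nat leq_exp2r // leq_add2l.
  by rewrite leq_mul2r ltnW ?orbT.
have : I%:R / 2 <= K%:R + 1 :> rat by apply: le_trans big _; apply: le_trans low up.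
by rewrite /I natrD natrM; lra.
Qed.
End CharacterSums.

(** * Positive definite ternary forms of determinant 1 *)

Definition dot (u v : int * int * int) : int :=
  u.1.1 * v.1.1 + u.1.2 * v.1.2 + u.2 * v.2.

Definition comb (p : int) (u : int * int * int) (q : int) (v : int * int * int) : int * int * int :=
  (p * u.1.1 + q * v.1.1, p * u.1.2 + q * v.1.2, p * u.2 + q * v.2).

Lemma dotC u v : dot u v = dot v u.
Proof. rewrite /dot; ring. Qed.

Lemma dot_comb p u q v w : dot (comb p u q v) w = p * dot u w + q * dot v w.
Proof. rewrite /dot /comb /=; ring. Qed.

Lemma dot_combr p u q v w : dot w (comb p u q v) = p * dot w u + q * dot w v.
Proof. by rewrite dotC dot_comb !(dotC _ w). Qed.

(** The Gram matrix is [[a, d, e], [d, b, f], [e, f, c]]. *)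
Definition is_gram (a b c d e f : int) : Prop :=
  exists u v w, [/\ dot u u = a, dot v v = b & dot w w = c] /\
                [/\ dot u v = d, dot u w = e & dot v w = f].

Lemma is_gram_swap a b c d e f : is_gram b a c d f e -> is_gram a b c d e f.
Proof.
move=> [u [v [w [[h1 h2 h3] [h4 h5 h6]]]]].
by exists v, u, w; split; split=> //; rewrite dotC.
Qed.

(** Base change adding k u to v and l u to w; the coefficients are those of the
    new Gram matrix. *)
Lemma is_gram_shift a b c d e f k l :
  is_gram a (b + 2 * k * d + k ^+ 2 * a) (c + 2 * l * e + l ^+ 2 * a)
    (d + k * a) (e + l * a) (f + k * e + l * d + k * l * a) ->
  is_gram a b c d e f.
Proof.
move=> [u [v [w [[h1 h2 h3] [h4 h5 h6]]]]].
exists u, (comb 1 v (- k) u), (comb 1 w (- l) u).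
split; split; rewrite ?dot_comb ?dot_combr ?(dotC v u) ?(dotC w u) ?(dotC w v).
all: rewrite ?h1 ?h2 ?h3 ?h4 ?h5 ?h6; ring.
Qed.

(** Base change p v + q w, r v + s w; the inverse change has integer
    coefficients because p s - q r = 1. *)
Lemma is_gram_unimodular a b c d e f p q r s : p * s - q * r = 1 ->
  is_gram a (p ^+ 2 * b + 2 * p * q * f + q ^+ 2 * c)
    (r ^+ 2 * b + 2 * r * s * f + s ^+ 2 * c)
    (p * d + q * e) (r * d + s * e)
    (p * r * b + (p * s + q * r) * f + q * s * c) ->
  is_gram a b c d e f.
Proof.
move=> det [u [v [w [[h1 h2 h3] [h4 h5 h6]]]]].
exists u, (comb s v (- q) w), (comb (- r) v p w).
have D x : x = (p * s - q * r) * x by rewrite det mul1r.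
have D2 x : x = (p * s - q * r) ^+ 2 * x by rewrite det expr1n mul1r.
split; split; rewrite ?dot_comb ?dot_combr ?(dotC w v) ?h1 ?h2 ?h3 ?h4 ?h5 ?h6 //.
- rewrite [RHS]D2; ring.
- rewrite [RHS]D2; ring.
- rewrite [RHS]D; ring.
- rewrite [RHS]D; ring.
- rewrite [RHS]D2; ring.
Qed.

Lemma centered_residue (a d : int) : 0 < a -> exists k, 2 * `|d + k * a| <= a.
Proof.
move=> a0; have E := divz_eq d a; have r0 := modz_ge0 d (lt0r_neq0 a0).
have r1 := ltz_pmod d a0; set q := (d %/ a)%Z in E; set r := (d %% a)%Z in E r0 r1.
have [h|h] := lerP (2 * r) a.
  by exists (- q); rewrite {1}E mulNr addrAC subrr add0r ger0_norm.
exists (- q - 1); rewrite {1}E.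
have -> : q * a + r + (- q - 1) * a = r - a by ring.
by rewrite ler0_norm; lia.
Qed.

(** Gauss reduction: once 2 |B| <= A <= C, one has A^2 <= A C <= D + A^2/4 for
    the determinant D; while C < A, exchanging the two vectors lowers A. *)
Lemma binary_reduction (A B C : int) : 0 < A -> 0 < A * C - B ^+ 2 ->
  exists p q r s, p * s - q * r = 1 /\
    3 * (A * p ^+ 2 + 2 * B * p * q + C * q ^+ 2) ^+ 2 <= 4 * (A * C - B ^+ 2).
Proof.
have [n An] : exists n, A = n%:Z \/ A < n%:Z by exists (`|A|%N.+1); right; lia.
elim/ltn_ind: n A B C An => n IH A B C An A0 D0.
have [k hk] := centered_residue B A0.
set B' := B + k * A in hk; pose C' := C + 2 * k * B + k ^+ 2 * A.
have DE : A * C' - B' ^+ 2 = A * C - B ^+ 2 by rewrite /B' /C'; ring.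
have [CA|AC] := ltrP C' A.
  have C0 : 0 < C' by rewrite -DE in D0; nia.
  have [p [q [r [s [det le]]]]] : exists p q r s, p * s - q * r = 1 /\
    3 * (C' * p ^+ 2 + 2 * - B' * p * q + A * q ^+ 2) ^+ 2 <= 4 * (C' * A - (- B') ^+ 2).
    apply: (IH `|C'|%N); [lia | left; lia | done |].
    by rewrite mulrC sqrrN DE.
  exists (k * p - q), p, (k * r - s), r; split; first by rewrite -det; ring.
  rewrite -DE; move: le; rewrite sqrrN [C' * A]mulrC; congr (3 * _ ^+ 2 <= _).
  by rewrite /B' /C'; ring.
exists 1, 0, 0, 1; split; first by ring.
rewrite !expr1n expr0n !mulr0 mulr1 !addr0 -DE.
nia.
Qed.

(** Hermite reduction.  With A = a b - d^2, B = a f - d e, C = a c - e^2, the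
    form (A, B, C) on the last two basis vectors has determinant a.  Reducing it
    gives 3 A^2 <= 4 a.  If moreover 2 |d| <= a, then either b < a and exchanging
    the first two vectors lowers a, or a^2 <= a b = A + d^2 gives 3 a^2 <= 4 A,
    and the two bounds force a = 1.  The basis can then be made orthonormal. *)
Lemma ternary_unimodular_is_gram (a b c d e f : int) :
  0 < a -> 0 < a * b - d ^+ 2 ->
  a * b * c + 2 * d * e * f - a * f ^+ 2 - b * e ^+ 2 - c * d ^+ 2 = 1 ->
  is_gram a b c d e f.
Proof.
have [n an] : exists n, a = n%:Z \/ a < n%:Z by exists (`|a|%N.+1); right; lia.
elim/ltn_ind: n a b c d e f an => n IH a b c d e f an a0 A0 det1.
set A := a * b - d ^+ 2 in A0; pose B := a * f - d * e; pose C := a * c - e ^+ 2.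
have DE : A * C - B ^+ 2 = a.
  by rewrite -[RHS]mulr1 -det1 /A /B /C; ring.
have [p [q [r [s [pqrs]]]]] : exists p q r s, p * s - q * r = 1 /\
    3 * (A * p ^+ 2 + 2 * B * p * q + C * q ^+ 2) ^+ 2 <= 4 * a.
  have D0 : 0 < A * C - B ^+ 2 by rewrite DE.
  by have := binary_reduction A0 D0; rewrite DE.
set A' := A * p ^+ 2 + _ + _ => leA.
have A'0 : 0 < A'.
  have AA : A * A' = (A * p + B * q) ^+ 2 + a * q ^+ 2 by rewrite /A' -DE; ring.
  rewrite -(pmulr_rgt0 _ A0) AA.
  have [q0|q0] := eqVneq q 0; last first.
    by rewrite ltr_wpDl ?sqr_ge0 // mulr_gt0 // lt0r sqrf_eq0 q0 sqr_ge0.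
  have p0 : p != 0 by apply/eqP => p0; move: pqrs; rewrite p0 q0 !mul0r subr0.
  by rewrite q0 expr0n !mulr0 !addr0 lt0r sqrf_eq0 mulf_eq0 negb_or (gt_eqF A0) p0 sqr_ge0.
apply: (is_gram_unimodular pqrs).
set b1 := p ^+ 2 * b + _ + _; set c1 := r ^+ 2 * b + _ + _.
set d1 := p * d + _; set e1 := r * d + _; set f1 := p * r * b + _ + _.
have A'E : a * b1 - d1 ^+ 2 = A' by rewrite /b1 /d1 /A' /A /B /C; ring.
have det2 : a * b1 * c1 + 2 * d1 * e1 * f1 - a * f1 ^+ 2 - b1 * e1 ^+ 2 - c1 * d1 ^+ 2 = 1.
  apply: etrans (_ : (p * s - q * r) ^+ 2 * _ = _); last by rewrite pqrs expr1n mul1r; exact: det1.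
  by rewrite /b1 /c1 /d1 /e1 /f1; ring.
clearbody b1 c1 d1 e1 f1 A'; clear DE B C pqrs p q r s det1 A0.
have [k hk] := centered_residue d1 a0.
have [l hl] := centered_residue e1 a0.
apply: (@is_gram_shift _ _ _ _ _ _ k l).
set b2 := b1 + _ + _; set c2 := c1 + _ + _; set d2 := d1 + _ in hk *; set e2 := e1 + _ in hl *.
set f2 := f1 + _ + _ + _.
have A'E2 : a * b2 - d2 ^+ 2 = A' by rewrite -A'E /b2 /d2; ring.
have det3 : a * b2 * c2 + 2 * d2 * e2 * f2 - a * f2 ^+ 2 - b2 * e2 ^+ 2 - c2 * d2 ^+ 2 = 1.
  by apply: etrans det2; rewrite /b2 /c2 /d2 /e2 /f2; ring.
clearbody b2 c2 d2 e2 f2; clear b1 c1 d1 e1 f1 A'E det2 k l b c d e f A.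
have b0 : 0 < b2 by nia.
have [ba|ab] := ltrP b2 a.
  apply: is_gram_swap; apply: (IH `|b2|%N); [lia | left; lia | done | | ].
    by rewrite mulrC A'E2.
  by apply: etrans det3; ring.
have h1 : 3 * a ^+ 2 <= 4 * A' by nia.
have a1 : a = 1 by nia.
subst a.
have d0 : d2 = 0 by lia.
have e0 : e2 = 0 by lia.
subst d2 e2.
have b1 : b2 = 1 by nia.
subst b2.
have pq : 1 * 1 - 0 * (- f2) = 1 :> int by ring.
apply: (is_gram_unimodular pq).
have cE : c2 = 1 + f2 ^+ 2 by lia.
exists (1, 0, 0), (0, 1, 0), (0, 0, 1).
by split; split; rewrite /dot /= ?cE; ring.
Qed.

(** The minor is the squared norm of the cross product of the first two vectors. *)
Lemma gram_minor_three_squares a b c d e f : is_gram a b c d e f ->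
  exists x y z : int, a * b - d ^+ 2 = x ^+ 2 + y ^+ 2 + z ^+ 2.
Proof.
move=> [[[u1 u2] u3] [[[v1 v2] v3] [w [[<- <- _] [<- _ _]]]]].
exists (u2 * v3 - u3 * v2), (u3 * v1 - u1 * v3), (u1 * v2 - u2 * v1).
by rewrite /dot /=; ring.
Qed.

(** * The quadratic character of a finite field *)

Definition quad_char (F : finFieldType) (x : F) : int :=
  if x == 0 then 0 else if [exists y : F, y ^+ 2 == x] then 1 else -1.

Lemma quad_char_values (F : finFieldType) (x : F) : quad_char x \in [:: 0; 1; -1].
Proof. by rewrite /quad_char; case: ifP => // _; case: ifP. Qed.

Lemma intr_sign_inj (F : fieldType) (s t : int) : (2%:R : F) != 0 ->
  s \in [:: 0; 1; -1] -> t \in [:: 0; 1; -1] -> s%:~R = t%:~R :> F -> s = t.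
Proof.
move=> F2; have N1 : (-1 : F) != 1.
  by apply: contra F2 => /eqP h; rewrite -[2%:R]/(1 + 1) -{1}h addNr.
have N0 : (-1 : F) != 0 by rewrite oppr_eq0 oner_eq0.
rewrite !inE => /or3P[] /eqP -> /or3P[] /eqP -> // /eqP.
all: rewrite ?mulr0z ?mulr1z ?mulrN1z ?oner_eq0 ?(negbTE N1) ?(negbTE N0) //.
- by rewrite eq_sym oner_eq0.
- by rewrite eq_sym (negbTE N0).
- by rewrite eq_sym (negbTE N1).
Qed.

Lemma finField_prim_root (F : finFieldType) : exists z : F, (#|F|.-1).-primitive_root z.
Proof.
have q0 : (0 < #|F|.-1)%N by rewrite -card_finField_unit; apply/card_gt0P; exists 1%g; rewrite inE.
pose rs := [seq x <- enum F | x != 0].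
have /hasP[z _ pz] : has (#|F|.-1).-primitive_root rs.
  apply: has_prim_root => //.
  - apply/allP => x; rewrite mem_filter => /andP[x0 _]; rewrite unity_rootE.
    apply/eqP/(mulfI x0); rewrite mulr1 -exprS prednK ?expf_card //.
    by apply/card_gt0P; exists 0.
  - by rewrite filter_uniq // enum_uniq.
  rewrite -[#|F|]/(#|predT|) -(cardC1 (0 : F)) cardE /rs.
  by rewrite {1}/enum_mem -enumT; apply: eq_leq; congr size; apply: eq_filter.
by exists z.
Qed.

Section Euler.
Variable F : finFieldType.
Hypothesis oddF : odd #|F|.

Let q0 : (0 < #|F|./2)%N.
Proof.
have q1 : (1 < #|F|)%N.
  rewrite -[X in (X < _)%N](cards1 (0 : F)) -cardsT; apply: proper_card.
  by rewrite properT; apply/eqP => /setP /(_ 1); rewrite !inE oner_eq0.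
by move: q1 oddF; case: #|F| => [|[|[|n]]].
Qed.

Let qE : #|F|.-1 = (2 * #|F|./2)%N.
Proof. by rewrite -{1}(odd_double_half #|F|) oddF add1n /= mul2n. Qed.

Lemma two_neq0 : (2%:R : F) != 0.
Proof.
have [z pz] := finField_prim_root F.
have z1 : z ^+ #|F|./2 != 1.
  by rewrite -(prim_order_dvd pz) qE gtnNdvd // ltn_Pmull.
have : (z ^+ #|F|./2 - 1) * (z ^+ #|F|./2 + 1) = 0.
  by rewrite -subr_sqr expr1n -exprM mulnC -qE (prim_expr_order pz) subrr.
move/eqP; rewrite mulf_eq0 subr_eq0 (negbTE z1) /= addr_eq0 => /eqP zN.
by apply: contra z1 => /eqP h; rewrite zN eq_sym -addr_eq0 -h.
Qed.

(** If q is the order of F and x is a power of a primitive root with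
    x^((q-1)/2) = 1, then q - 1 divides (q - 1)/2 times the exponent, which is
    therefore even, so that x is a square. *)
Lemma Euler_criterion (x : F) : (quad_char x)%:~R = x ^+ #|F|./2.
Proof.
rewrite /quad_char; have [->|x0] := eqVneq; first by rewrite expr0n gtn_eqF.
have xq y : y != 0 -> y ^+ (2 * #|F|./2) = 1 :> F.
  move=> y0; apply: (mulfI y0); rewrite mulr1 -qE -exprS prednK ?expf_card //.
  by apply/card_gt0P; exists 0.
have [/existsP[y /eqP yx]|no] := boolP [exists y, y ^+ 2 == x].
  rewrite -yx -exprM xq //; apply: contraNneq x0 => y0.
  by rewrite -yx y0 expr0n.
have : (x ^+ #|F|./2 - 1) * (x ^+ #|F|./2 + 1) = 0.
  by rewrite -subr_sqr expr1n -exprM mulnC xq // subrr.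
move/eqP; rewrite mulf_eq0 subr_eq0 addr_eq0 => /orP[|/eqP -> //].
have [z pz] := finField_prim_root F.
have [i xE] := prim_rootP pz (etrans (congr1 _ qE) (xq _ x0)).
rewrite xE -exprM -(prim_order_dvd pz) => d.
have /dvdnP[j ij] : (2 %| i)%N by rewrite -(dvdn_pmul2r q0) -qE.
by case/existsP: no; exists (z ^+ j); rewrite xE ij exprM.
Qed.

Lemma quad_charM (x y : F) : quad_char (x * y) = quad_char x * quad_char y.
Proof.
apply: (intr_sign_inj two_neq0 (quad_char_values _)).
  have := quad_char_values x; have := quad_char_values y.
  by rewrite !inE => /or3P[] /eqP -> /or3P[] /eqP ->.
by rewrite rmorphM /= !Euler_criterion exprMn.
Qed.

Lemma quad_char0 : quad_char (0 : F) = 0.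
Proof. by rewrite /quad_char eqxx. Qed.

Lemma quad_char1 : quad_char (1 : F) = 1.
Proof.
apply: (intr_sign_inj two_neq0 (quad_char_values _)); rewrite ?inE //.
by rewrite Euler_criterion expr1n.
Qed.

Lemma quad_char_sq (x : F) : quad_char x ^+ 2 = (x != 0)%:R.
Proof. by rewrite /quad_char; case: eqVneq => //; case: ifP. Qed.

Lemma quad_charN1 : quad_char (-1 : F) = (-1) ^+ #|F|./2.
Proof.
apply: (intr_sign_inj two_neq0 (quad_char_values _)).
  by rewrite -signr_odd; case: odd.
by rewrite Euler_criterion rmorphXn.
Qed.

(** Multiplication by a primitive root, a non-square, changes the sign. *)
Lemma sum_quad_char : \sum_(x : F) quad_char x = 0.
Proof.
have [z pz] := finField_prim_root F.
have zN : quad_char z = -1.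
  have : quad_char z != 1.
    apply/eqP => h; have := Euler_criterion z; rewrite h => /esym/eqP.
    by rewrite -(prim_order_dvd pz) qE gtnNdvd // ltn_Pmull.
  have : z != 0.
    apply/eqP => z0; move/eqP: (prim_expr_order pz); rewrite z0 qE expr0n muln_eq0.
    by rewrite (gtn_eqF q0) /= mulr0n eq_sym oner_eq0.
  by rewrite /quad_char => /negbTE ->; case: ifP.
have z0 : z != 0 by apply/eqP => h; move: zN; rewrite h quad_char0.
have : \sum_(x : F) quad_char x = - \sum_(x : F) quad_char x.
  rewrite {1}(reindex_inj (mulfI z0)) /= -sumrN.
  by apply: eq_bigr => x _; rewrite quad_charM zN mulN1r.
lia.
Qed.

(** Here psi is a nontrivial additive character of F with values in L. *)
Variables (L : fieldType) (psi : F -> L).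
Hypotheses (psi0 : psi 0 = 1) (psiD : forall a b, psi (a + b) = psi a * psi b)
  (psi_sum : \sum_a psi a = 0).

Definition Gauss_sum : L := \sum_a (quad_char a)%:~R * psi a.

(** Substituting b = a c in the double sum over a and b turns it into the sum over
    c of quad_char(c) times the sum over a <> 0 of psi(a (1 + c)), which is
    #|F| - 1 for c = -1 and -1 for the other c. *)
Lemma Gauss_sum_sqr : Gauss_sum ^+ 2 = (quad_char (-1 : F))%:~R * #|F|%:R.
Proof.
have psi_sumM t : \sum_a psi (a * t) = (t == 0)%:R * #|F|%:R.
  have [->|t0] := eqVneq.
    by under eq_bigr do rewrite mulr0 psi0; rewrite sumr_const mul1r.
  by rewrite mul0r -[RHS]psi_sum [RHS](reindex_inj (mulIf t0)).
have step a : (quad_char a)%:~R * psi a * Gauss_sum =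
    \sum_c (quad_char c)%:~R * (psi (a * (1 + c)) - (a == 0)%:R).
  have [->|a0] := eqVneq a 0.
    rewrite quad_char0 !mul0r big1 // => c _.
    by rewrite mul0r psi0 subrr mulr0.
  rewrite /Gauss_sum mulr_sumr (reindex_inj (mulfI a0)) /=; apply: eq_bigr => c _.
  rewrite subr0 mulrDr mulr1 psiD quad_charM rmorphM /=.
  have aa : (quad_char a)%:~R * (quad_char a)%:~R = 1 :> L.
    by rewrite -rmorphM -expr2 quad_char_sq a0.
  by apply: etrans (mul1r _); rewrite -[X in _ = X * _]aa; ring.
rewrite expr2 {1}/Gauss_sum mulr_suml; under eq_bigr do rewrite step.
rewrite exchange_big /= (bigD1 (-1)) //= -mulr_sumr sumrB psi_sumM.
rewrite subrr eqxx mul1r (bigD1 0) //= eqxx big1 ?addr0; last by move=> a /negbTE ->.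
under eq_bigr => c cN.
  rewrite -mulr_sumr sumrB psi_sumM [1 + c]addrC addr_eq0 (negbTE cN) mul0r sub0r.
  rewrite (bigD1 0) //= eqxx big1 ?addr0; last by move=> a /negbTE ->.
  rewrite mulrN1; over.
rewrite sumrN -rmorph_sum /=.
have := sum_quad_char; rewrite (bigD1 (-1)) //= => /eqP.
rewrite addrC addr_eq0 => /eqP ->.
by rewrite rmorphN opprK mulrBr mulr1 subrK.
Qed.

(** The Frobenius of L replaces psi(a) by psi(r a) and fixes the coefficients. *)
Lemma Gauss_sum_Frobenius r : prime r -> odd r -> r \in [pchar L] -> (r%:R : F) != 0 ->
  (forall a, psi a ^+ r = psi (a * r%:R)) ->
  Gauss_sum ^+ r = (quad_char (r%:R : F))%:~R * Gauss_sum.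
Proof.
move=> pr oddr rL rF psir.
rewrite -(pFrobenius_autE rL) /Gauss_sum rmorph_sum /= mulr_sumr.
rewrite [RHS](reindex_inj (mulIf rF)) /=; apply: eq_bigr => a _.
rewrite pFrobenius_autE exprMn psir quad_charM rmorphM /=.
have rr : (quad_char (r%:R : F))%:~R * (quad_char (r%:R : F))%:~R = 1 :> L.
  by rewrite -rmorphM -expr2 quad_char_sq rF.
set ca := (quad_char a)%:~R; set cr := (quad_char _)%:~R in rr *.
have -> : cr * (ca * cr * psi (a * r%:R)) = cr * cr * (ca * psi (a * r%:R)) by ring.
rewrite rr mul1r {}/ca.
congr (_ * _); rewrite -rmorphXn; congr (_%:~R).
have := quad_char_values a; rewrite !inE => /or3P[] /eqP ->.
- by rewrite expr0n gtn_eqF // prime_gt0.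
- by rewrite expr1n.
- by rewrite -signr_odd oddr.
Qed.
End Euler.

(** * Quadratic reciprocity *)

Lemma odd_prime_gt2 p : prime p -> odd p -> (2 < p)%N.
Proof. by case: p => [|[|[|p]]]. Qed.

Lemma finField_pchar_prim_root r k d : prime r -> (0 < k)%N -> (d %| (r ^ k).-1)%N ->
  exists (L : finFieldType) (z : L), r \in [pchar L] /\ d.-primitive_root z.
Proof.
move=> pr k0 dr; have [L rL cardL] := pPrimePowerField pr k0.
have [z pz] := finField_prim_root L; rewrite cardL in pz.
by exists L, (z ^+ ((r ^ k).-1 %/ d)); split=> //; apply: dvdn_prim_root.
Qed.

Definition legendre (a : int) (p : nat) : int := quad_char (a%:~R : 'F_p).

Section Legendre.
Variable p : nat.
Hypotheses (pp : prime p) (op : odd p).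

Let oddFp : odd #|'F_p|. Proof. by rewrite card_Fp. Qed.

Lemma legendreM a b : legendre (a * b) p = legendre a p * legendre b p.
Proof. by rewrite /legendre rmorphM quad_charM. Qed.

Lemma legendre1 : legendre 1 p = 1.
Proof. by rewrite /legendre quad_char1. Qed.

Lemma legendreN1 : legendre (-1) p = (-1) ^+ p./2.
Proof. by rewrite /legendre rmorphN quad_charN1 // card_Fp. Qed.

Lemma Fp_intr_eq0 m : ((m%:~R : 'F_p) == 0) = (p %| `|m|)%N.
Proof.
rewrite (dvdn_pcharf (pchar_Fp pp)); case: m => n //.
by rewrite NegzE rmorphN oppr_eq0 abszN.
Qed.

Lemma legendre_sq a : legendre a p ^+ 2 = (~~ (p %| `|a|)%N)%:R.
Proof. by rewrite /legendre quad_char_sq Fp_intr_eq0. Qed.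

Lemma legendre_values a : legendre a p \in [:: 0; 1; -1].
Proof. exact: quad_char_values. Qed.

Lemma intr_pchar (L : fieldType) (m : int) : p \in [pchar L] ->
  m%:~R = 0 :> 'F_p -> m%:~R = 0 :> L.
Proof.
move=> pL /eqP; rewrite Fp_intr_eq0 (dvdn_pcharf pL); case: m => n /eqP h //.
by rewrite NegzE rmorphN /= -pmulrn h oppr0.
Qed.

(** Euler's criterion holds modulo p, hence in every field of characteristic p. *)
Lemma Euler_pchar (L : fieldType) (a : int) : p \in [pchar L] ->
  (legendre a p)%:~R = a%:~R ^+ p./2 :> L.
Proof.
move=> pL; apply/eqP; rewrite -rmorphXn -subr_eq0 -rmorphB /=; apply/eqP.
apply: (intr_pchar pL); rewrite rmorphB rmorphXn /= /legendre.
by rewrite Euler_criterion // card_Fp // subrr.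
Qed.

Lemma pchar_two_neq0 (L : fieldType) : p \in [pchar L] -> (2%:R : L) != 0.
Proof.
move=> pL; rewrite -(dvdn_pcharf pL) gtnNdvd //; exact: odd_prime_gt2.
Qed.
End Legendre.

(** For tau the Gauss sum of F_p in a field of characteristic r containing a
    primitive p-th root of unity, tau^(r-1) is legendre r p by Frobenius, and it
    is also the ((r-1)/2)-th power of tau^2 = legendre (-1) p * p, which Euler's
    criterion modulo r evaluates. *)
Theorem quadratic_reciprocity p r : prime p -> odd p -> prime r -> odd r -> p != r ->
  legendre p r = legendre r p * (-1) ^+ (p./2 * r./2).
Proof.
move=> pp op pr or pr'.
have p1 : (0 < p.-1)%N by rewrite -subn1 subn_gt0 prime_gt1.
have ndvd : ~~ (p %| r)%N by rewrite dvdn_prime2.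
have dr : (p %| (r ^ p.-1).-1)%N.
  rewrite -subn1 -eqn_mod_dvd ?expn_gt0 ?prime_gt0 // -totient_prime //.
  by apply/eqP; rewrite Euler_exp_totient // coprime_sym prime_coprime.
have [L [z [rL pz]]] := finField_pchar_prim_root pr p1 dr.
pose psi (a : 'F_p) : L := z ^+ a.
have psiN n : psi n%:R = z ^+ n by rewrite /psi val_Fp_nat // (prim_expr_mod pz).
have natE (a : 'F_p) : a = (a : nat)%:R by rewrite natr_Zp.
have psiD a b : psi (a + b) = psi a * psi b.
  by rewrite [a]natE [b]natE -natrD !psiN exprD.
have psi0 : psi 0 = 1 by rewrite -[0]/(0%:R) psiN.
have psi_sum : \sum_a psi a = 0.
  have z1 : psi 1 != 1.
    rewrite -[1]/(1%:R) psiN -(prim_order_dvd pz) dvdn1.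
    by rewrite gtn_eqF // prime_gt1.
  have : \sum_a psi a = psi 1 * \sum_a psi a.
    rewrite mulr_sumr {1}(reindex_inj (addrI 1)) /=.
    by apply: eq_bigr => a _; rewrite psiD.
  move/eqP; rewrite -subr_eq0 -[X in X - _]mul1r -mulrBl mulf_eq0 subr_eq0.
  by rewrite eq_sym (negbTE z1) => /eqP.
have oFp : odd #|'F_p| by rewrite card_Fp.
have rp : (r%:R : 'F_p) != 0 by rewrite -(dvdn_pcharf (pchar_Fp pp)).
have psir a : psi a ^+ r = psi (a * r%:R).
  by rewrite [a]natE -natrM !psiN exprM.
have sq := Gauss_sum_sqr oFp psi0 psiD psi_sum.
have frob := Gauss_sum_Frobenius oFp pr or rL rp psir.
set tau := Gauss_sum psi in sq frob.
have pL : (p%:R : L) != 0.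
  by rewrite -(dvdn_pcharf rL) dvdn_prime2 // eq_sym.
have tau0 : tau != 0.
  apply/eqP => t0; move/eqP: sq; rewrite t0 expr0n card_Fp // eq_sym mulf_eq0 (negbTE pL) orbF.
  rewrite quad_charN1 // -signr_odd; case: odd; rewrite ?mulrN1z ?oppr_eq0 oner_eq0 //.
have key : (legendre r p)%:~R = ((-1) ^+ (p./2 * r./2) * legendre p r)%:~R :> L.
  apply: (mulIf tau0); rewrite -frob rmorphM /= (Euler_pchar pr or p rL).
  rewrite -[in LHS](odd_double_half r) or add1n exprSr -muln2 mulnC exprM sq.
  by rewrite card_Fp // quad_charN1 // card_Fp // exprMn -rmorphXn -exprM.
have := intr_sign_inj (pchar_two_neq0 pr or rL) (legendre_values p r) _ key.
have sgn : (-1 : int) ^+ (p./2 * r./2) * (-1) ^+ (p./2 * r./2) = 1.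
  by rewrite -expr2 sqrr_sign.
move=> ->; last first.
  have := legendre_values r p; rewrite !inE -signr_odd.
  by case: odd => /or3P[] /eqP ->.
by rewrite mulrAC sgn mul1r.
Qed.

(** The same argument with t = z + z^(-1) for z a primitive 8-th root of unity:
    t^2 = 2, and t^r is t or -t according to r modulo 8. *)
Theorem legendre2 r : prime r -> odd r ->
  legendre 2 r = if (r %% 8 \in [:: 1; 7])%N then 1 else -1.
Proof.
move=> pr or.
have dr : (8 %| (r ^ 2).-1)%N.
  rewrite -(odd_double_half r) or; set n := r./2.
  have : exists m, (n * n.+1 = 2 * m)%N.
    by exists (n * n.+1)./2; have := odd_double_half (n * n.+1); rewrite oddM /= andbN mul2n.
  by move=> [m h]; apply/dvdnP; exists m; rewrite -mul2n; nia.
have [L [z [rL pz]]] := finField_pchar_prim_root pr (isT : (0 < 2)%N) dr.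
have z8 : z ^+ 8 = 1 := prim_expr_order pz.
have z4 : z ^+ 4 = -1.
  have : z ^+ 4 != 1 by rewrite -(prim_order_dvd pz).
  have : (z ^+ 4 - 1) * (z ^+ 4 + 1) = 0 by rewrite -subr_sqr expr1n -exprM z8 subrr.
  by move/eqP; rewrite mulf_eq0 subr_eq0 addr_eq0 => /orP[->|/eqP].
have z0 : z != 0.
  by apply/eqP => h; move/eqP: z8; rewrite h expr0n eq_sym oner_eq0.
pose t := z + z ^+ 7.
have t2 : t ^+ 2 = 2%:R.
  have -> : t ^+ 2 = z ^+ 2 + z ^+ 8 * 2%:R + z ^+ 8 * (z ^+ 4 * z ^+ 2) by rewrite /t; ring.
  by rewrite z8 z4; ring.
have t0 : t != 0.
  by rewrite -(sqrf_eq0 t) t2 (pchar_two_neq0 pr or rL).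
have tr : t ^+ r = (if (r %% 8 \in [:: 1; 7])%N then 1 else -1) * t.
  rewrite -(pFrobenius_autE rL) rmorphD /= !pFrobenius_autE -exprM mulnC exprM.
  rewrite -(prim_expr_mod pz r).
  have : odd (r %% 8)%N by rewrite odd_mod.
  have : (r %% 8 < 8)%N by rewrite ltn_mod.
  have tE : t = z + z ^+ 4 * z ^+ 3 by rewrite /t; ring.
  case: (r %% 8)%N => [|[|[|[|[|[|[|[|m]]]]]]]] //= _ _.
  - by rewrite /t; ring.
  - have -> : z ^+ 3 + (z ^+ 3) ^+ 7 = z ^+ 3 + (z ^+ 4) ^+ 5 * z by ring.
    by rewrite tE z4; ring.
  - have -> : z ^+ 5 + (z ^+ 5) ^+ 7 = z ^+ 4 * z + (z ^+ 4) ^+ 8 * z ^+ 3 by ring.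
    by rewrite tE z4; ring.
  - have -> : z ^+ 7 + (z ^+ 7) ^+ 7 = z ^+ 4 * z ^+ 3 + (z ^+ 4) ^+ 12 * z by ring.
    by rewrite tE z4; ring.
apply: (intr_sign_inj (pchar_two_neq0 pr or rL) (legendre_values r 2)).
  by case: ifP.
rewrite (Euler_pchar pr or 2 rL); apply: (mulIf t0).
have -> : (2%:~R : L) = t ^+ 2 by rewrite t2.
rewrite -exprM -exprSr mul2n.
have -> : (r./2).*2.+1 = r by rewrite -[RHS](odd_double_half r) or.
by rewrite tr; case: ifP.
Qed.

(** * Jacobi symbols *)

Definition odd_primes (s : seq nat) := all (fun p => prime p && odd p) s.

Definition prodn (s : seq nat) : nat := \prod_(p <- s) p.

Lemma odd_prime_list n : odd n -> exists2 s, odd_primes s & n = prodn s.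
Proof.
elim/ltn_ind: n => n IH on; have [->|n1] := eqVneq n 1%N.
  by exists [::]; rewrite // /prodn big_nil.
have n0 : (0 < n)%N by rewrite odd_gt0.
have n2 : (1 < n)%N by rewrite ltn_neqAle eq_sym n1.
have [m nE] := dvdnP (pdiv_dvd n).
have pp := pdiv_prime n2.
have /andP[om op] : odd m && odd (pdiv n) by rewrite -oddM -nE.
have mn : (m < n)%N by rewrite nE ltn_Pmulr ?prime_gt1 // odd_gt0.
have [s os mE] := IH m mn om.
by exists (pdiv n :: s); rewrite /= ?pp ?op // /prodn big_cons {1}nE mE mulnC.
Qed.

Lemma odd_primes_odd s : odd_primes s -> odd (prodn s).
Proof.
rewrite /prodn; elim: s => [|p s IH]; first by rewrite big_nil.
by rewrite big_cons oddM => /= /andP[/andP[_ ->]].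
Qed.

Definition sign_mod4 (n : nat) : int := (-1) ^+ n./2.
Definition sign_mod8 (n : nat) : int := if (n %% 8 \in [:: 1; 7])%N then 1 else -1.

Lemma sign_mod4M a b : odd a -> odd b -> sign_mod4 (a * b) = sign_mod4 a * sign_mod4 b.
Proof.
move=> oa ob; rewrite /sign_mod4 -exprD -signr_odd -[RHS]signr_odd; congr (_ ^+ (nat_of_bool _)).
rewrite -{1}(odd_double_half a) -{1}(odd_double_half b) oa ob; set i := a./2; set j := b./2.
have -> : ((true + i.*2) * (true + j.*2) = (2 * (i * j) + i + j).*2.+1)%N.
  by rewrite /= -!mul2n -addn1; ring.
by rewrite /= uphalf_double -addnA mul2n oddD odd_double.
Qed.

Lemma sign_mod4_mod a : sign_mod4 (a %% 4) = sign_mod4 a.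
Proof.
rewrite /sign_mod4 -signr_odd -[RHS]signr_odd; congr (_ ^+ (nat_of_bool _)).
by have := divn_eq a 4; have := ltn_pmod a (isT : (0 < 4)%N); lia.
Qed.

Lemma sign_mod8M a b : odd a -> odd b -> sign_mod8 (a * b) = sign_mod8 a * sign_mod8 b.
Proof.
rewrite /sign_mod8 -modnMml -modnMmr.
rewrite -(odd_mod a (erefl : odd 8 = false)) -(odd_mod b (erefl : odd 8 = false)).
have := ltn_pmod a (isT : (0 < 8)%N); have := ltn_pmod b (isT : (0 < 8)%N).
move: (a %% 8)%N (b %% 8)%N => x y.
by case: x => [|[|[|[|[|[|[|[|x]]]]]]]] //; case: y => [|[|[|[|[|[|[|[|y]]]]]]]].
Qed.

(** The denominator is carried by a list of odd primes, with multiplicities, so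
    that identities follow from those for primes by induction on the list. *)
Definition jacobi (s : seq nat) (a : int) : int := \prod_(p <- s) legendre a p.

Lemma jacobiM s a b : odd_primes s -> jacobi s (a * b) = jacobi s a * jacobi s b.
Proof.
rewrite /jacobi => os; rewrite -big_split !big_seq; apply: eq_bigr => p ps.
by have /andP[pp op] := allP os _ ps; rewrite legendreM.
Qed.

Lemma jacobi_congr s a b : odd_primes s -> (prodn s %| `|(a - b)%R|)%N ->
  jacobi s a = jacobi s b.
Proof.
rewrite /jacobi => os d; rewrite !big_seq; apply: eq_bigr => p ps.
have /andP[pp op] := allP os _ ps; rewrite /legendre; congr quad_char.
apply/eqP; rewrite -subr_eq0 -rmorphB Fp_intr_eq0 //.
by apply: dvdn_trans d; rewrite /prodn (big_rem p) // dvdn_mulr.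
Qed.

Lemma jacobi_sq s (a : nat) : odd_primes s -> jacobi s a ^+ 2 = (coprime a (prodn s))%:R.
Proof.
rewrite /jacobi /prodn; elim: s => [|p s IH] os; first by rewrite !big_nil coprimen1.
move: os => /= /andP[/andP[pp op] os]; rewrite !big_cons exprMn (IH os) coprimeMr.
by rewrite legendre_sq // absz_nat -prime_coprime // coprime_sym -natrM mulnb.
Qed.

Lemma jacobiN1 s : odd_primes s -> jacobi s (-1) = sign_mod4 (prodn s).
Proof.
rewrite /jacobi /prodn; elim: s => [|p s IH] os; first by rewrite !big_nil.
move: os => /= /andP[/andP[pp op] os]; rewrite !big_cons (IH os) legendreN1 //.
by rewrite sign_mod4M // odd_primes_odd.
Qed.

Lemma jacobi2 s : odd_primes s -> jacobi s 2 = sign_mod8 (prodn s).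
Proof.
rewrite /jacobi /prodn; elim: s => [|p s IH] os; first by rewrite !big_nil.
move: os => /= /andP[/andP[pp op] os]; rewrite !big_cons (IH os) legendre2 //.
by rewrite sign_mod8M // odd_primes_odd.
Qed.

Lemma jacobi_reciprocity s r : odd_primes s -> prime r -> odd r -> r \notin s ->
  legendre (prodn s) r = jacobi s r * (-1) ^+ (r./2 * (prodn s)./2).
Proof.
move=> + pr or; rewrite /jacobi /prodn; elim: s => [|p s IH] os.
  by rewrite !big_nil muln0 expr0 legendre1.
move: os => /= /andP[/andP[pp op] os]; rewrite inE negb_or => /andP[rp rs].
rewrite !big_cons PoszM legendreM // (IH os rs).
rewrite (quadratic_reciprocity pp op pr or); last by rewrite eq_sym.
have E : (-1 : int) ^+ (r./2 * (p * \prod_(q <- s) q)./2) =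
   (-1) ^+ (p./2 * r./2) * (-1) ^+ (r./2 * (\prod_(q <- s) q)./2).
  have := sign_mod4M op (odd_primes_odd os); rewrite /sign_mod4 /prodn => h.
  by rewrite mulnC exprM h exprMn -!exprM [(_ * r./2)%N in X in _ * X]mulnC.
rewrite E; ring.
Qed.

(** * The three-square theorem *)

(** The symbol (-n / a) for n = 2^e N, N the product of s, rewritten by reciprocity
    so that its dependence on a modulo 8 N is visible. *)
Definition neg_char (e : nat) (s : seq nat) (a : nat) : int :=
  if odd a then sign_mod4 a ^+ (1 + (prodn s)./2) * sign_mod8 a ^+ e * jacobi s a else 0.

Lemma sign_mod4_sq a : sign_mod4 a ^+ 2 = 1.
Proof. by rewrite /sign_mod4 sqrr_sign. Qed.

Lemma sign_mod8_sq a : sign_mod8 a ^+ 2 = 1.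
Proof. by rewrite /sign_mod8; case: ifP. Qed.

Lemma neg_char_real e s : odd_primes s -> real_character (8 * prodn s) (neg_char e s).
Proof.
move=> os; have oN := odd_primes_odd os; have N0 : (0 < prodn s)%N by rewrite odd_gt0.
split.
- by rewrite (leq_trans _ (leq_pmulr 8 N0)).
- move=> a; set M := (8 * prodn s)%N.
  have m8 : (a %% M = a %[mod 8])%N by rewrite modn_dvdm // dvdn_mulr.
  have m4 : (a %% M = a %[mod 4])%N.
    by rewrite modn_dvdm // /M (dvdn_trans _ (dvdn_mulr _ (dvdnn 8))).
  rewrite /neg_char -(odd_mod _ (erefl : odd 8 = false)) m8 odd_mod //.
  rewrite -(sign_mod4_mod (a %% M)) m4 sign_mod4_mod /sign_mod8 m8.
  rewrite (@jacobi_congr s (a %% M)%N a) //.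
  apply: (@dvdn_trans M); first exact: dvdn_mull.
  by rewrite {2}(divn_eq a M) PoszD opprD addrCA subrr addr0 abszN absz_nat dvdn_mull.
- move=> a b; rewrite /neg_char oddM; case: (boolP (odd a)) => oa /=; last by rewrite mul0r.
  case: (boolP (odd b)) => ob /=; last by rewrite mulr0.
  by rewrite sign_mod4M // sign_mod8M // PoszM jacobiM // !exprMn; ring.
move=> a; rewrite /neg_char coprimeMr (coprime_pexpr a 2 (isT : 0 < 3)%N).
case: (boolP (odd a)) => oa; last by rewrite expr0n coprimen2 (negbTE oa).
rewrite coprimen2 oa /= !exprMn -!exprM ![(_ * 2)%N]mulnC !exprM.
by rewrite sign_mod4_sq sign_mod8_sq !expr1n !mul1r jacobi_sq.
Qed.

Lemma legendre_neg_char e s r : (e <= 1)%N -> odd_primes s -> prime r -> odd r ->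
  coprime r (8 * prodn s) -> legendre (- (2 ^ e * prodn s)%N%:Z) r = neg_char e s r.
Proof.
move=> e1 os pr or; rewrite coprimeMr => /andP[_ cr].
have rs : r \notin s.
  apply: contraL cr => rs; rewrite prime_coprime // negbK.
  by rewrite /prodn (big_rem r) //= dvdn_mulr.
rewrite /neg_char or -mulN1r PoszM !legendreM // legendreN1 //.
rewrite (jacobi_reciprocity os pr or rs).
have -> : legendre (2 ^ e)%N r = sign_mod8 r ^+ e.
  by case: e e1 => [|[|e]] // _; rewrite ?expn0 ?legendre1 // expn1 legendre2.
rewrite /sign_mod4 exprD expr1 -exprM; ring.
Qed.

Lemma legendre_root (a : int) r : prime r -> legendre a r = 1 ->
  exists y : nat, (r %| `|y%:Z ^+ 2 - a|)%N.
Proof.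
move=> pr; rewrite /legendre /quad_char; case: ifP => // _; case: ifP => // /existsP[y /eqP h] _.
exists (y : nat); rewrite -Fp_intr_eq0 // rmorphB rmorphXn /= -pmulrn natr_Zp h subrr.
by [].
Qed.

(** q is the product of the primes with odd exponent in K; the Chinese remainder
    theorem glues the roots modulo these primes. *)
Lemma squarefree_root (n K : nat) : (0 < K)%N ->
  (forall r, prime r -> odd (logn r K) -> exists y, r %| y ^ 2 + n)%N ->
  exists q s B, K = (q * s ^ 2)%N /\ (q %| B ^ 2 + n)%N.
Proof.
elim/ltn_ind: K => K IH K0 H.
have [K1|K1] := eqVneq K 1%N.
  by exists 1%N, 1%N, 0%N; rewrite K1 dvd1n.
have Kgt1 : (1 < K)%N by rewrite ltn_neqAle eq_sym K1.
set p := pdiv K; have pp : prime p := pdiv_prime Kgt1.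
have [K' cK' KE] := pfactor_coprime pp K0; set e := logn p K in KE.
have e0 : (0 < e)%N by rewrite logn_gt0 mem_primes pp K0 pdiv_dvd.
have K'0 : (0 < K')%N by move: K0; rewrite KE muln_gt0 => /andP[].
have K'K : (K' < K)%N.
  by rewrite KE ltn_Pmulr // -(exp1n e) ltn_exp2r // prime_gt1.
have pe0 : (0 < p ^ e)%N by rewrite expn_gt0 prime_gt0.
have lp : logn p K' = 0%N.
  by rewrite lognE pp K'0 /=; move: cK'; rewrite prime_coprime // => /negbTE ->.
have lk r : prime r -> r != p -> logn r K = logn r K'.
  move=> pr rp; rewrite KE lognM // lognX (logn_prime r pp) (negbTE rp) muln0.
  by rewrite addn0.
have [|q [s [B [K'E dB]]]] := IH K' K'K K'0.
  move=> r pr; have [->|rp] := eqVneq r p; first by rewrite lp.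
  by rewrite -lk //; apply: H.
have [oe|ee] := boolP (odd e); last first.
  exists q, (s * p ^ e./2)%N, B; split=> //.
  rewrite KE {1}K'E expnMn -expnM muln2 mulnA; congr (_ * p ^ _)%N.
  by rewrite -{1}(odd_double_half e) (negbTE ee).
have [y dy] := H p pp oe.
have cqp : coprime q p.
  by rewrite coprime_sym; apply: coprime_dvdr cK'; rewrite K'E dvdn_mulr.
exists (q * p)%N, (s * p ^ e./2)%N, (chinese q p B y); split.
  rewrite KE {1}K'E expnMn -expnM muln2 -{1}(odd_double_half e) oe add1n (expnS p).
  by rewrite mulnACA.
rewrite Gauss_dvd //; apply/andP; split.
  rewrite /dvdn -modnDml -modnXm chinese_modl // modnXm modnDml.
  exact: dB.
rewrite /dvdn -modnDml -modnXm chinese_modr // modnXm modnDml.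
exact: dy.
Qed.

(** The form [[q, B, 0], [B, C, s], [0, s, t]] with K = q s^2, q C = B^2 + n and
    t n = K + 1 has determinant t (q C - B^2) - q s^2 = t n - K = 1. *)
Lemma three_squares_of_class (n K : nat) : (0 < n)%N -> (0 < K)%N -> (n %| K.+1)%N ->
  (forall r, prime r -> odd (logn r K) -> exists y, r %| y ^ 2 + n)%N ->
  exists x y z : int, n%:Z = x ^+ 2 + y ^+ 2 + z ^+ 2.
Proof.
move=> n0 K0 /dvdnP[t tE] H.
have [q [s [B [KE /dvdnP[C CE]]]]] := squarefree_root K0 H.
have q0 : (0 < q)%N by move: K0; rewrite KE muln_gt0 => /andP[].
have CZ : C%:Z * q = B%:Z ^+ 2 + n by rewrite -PoszM -CE PoszD -!natz natrX.
have tZ : t%:Z * n = q%:Z * s%:Z ^+ 2 + 1.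
  by rewrite -PoszM -tE KE -addn1 PoszD PoszM -!natz natrX.
have minor : q%:Z * C - B%:Z ^+ 2 = n by rewrite mulrC CZ addrAC subrr add0r.
have /gram_minor_three_squares[x [y [z h]]] : is_gram q C t B 0 s.
  apply: ternary_unimodular_is_gram; rewrite ?minor //.
  transitivity (t%:Z * (q%:Z * C - B%:Z ^+ 2) - q%:Z * s%:Z ^+ 2); first by ring.
  by rewrite minor tZ; ring.
by exists x, y, z; rewrite -h minor.
Qed.

(** The divisor sum being positive at some k = c, take K = 2^i k.  The prime 2 is
    harmless, as -n is always a square modulo 2; the factor 2^i is needed when no
    class c = -1 modulo n has character 1. *)
Lemma three_squares_of_character e s c i n : (e <= 1)%N -> odd_primes s ->
  n = (2 ^ e * prodn s)%N -> neg_char e s c = 1 -> (n %| (2 ^ i * c).+1)%N ->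
  exists x y z : int, n%:Z = x ^+ 2 + y ^+ 2 + z ^+ 2.
Proof.
move=> e1 os nE chic nc.
have chiP := neg_char_real e os; set M := (8 * prodn s)%N in chiP.
have [_ _ chiM chisq] := chiP.
have oN := odd_primes_odd os; have N0 : (0 < prodn s)%N by rewrite odd_gt0.
have n0 : (0 < n)%N by rewrite nE muln_gt0 expn_gt0.
have cM : coprime c M by have := chisq c; rewrite chic expr1n; case: coprime.
have [k [k0 kc fk]] := positive_divisor_sum_in_class chiP cM chic.
have [_ fodd _] := divisor_sum_spec chiM (real_character1 chiP) (real_character_values chiP) k0.
have kM : coprime k M by rewrite -coprime_modl kc coprime_modl.
apply: (@three_squares_of_class n (2 ^ i * k)) => //.
- by rewrite muln_gt0 expn_gt0.
- have nM : (n %| M)%N.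
    rewrite nE dvdn_pmul2r //; exact: (dvdn_exp2l 2 (leq_trans e1 (isT : 1 <= 3)%N)).
  rewrite /dvdn -addn1 -modnDml -modnMmr.
  rewrite -(modn_dvdm k nM) kc (modn_dvdm c nM) modnMmr modnDml addn1.
  exact: nc.
move=> r pr; have [->|r2] := eqVneq r 2%N.
  by exists n; rewrite dvdn2 oddD oddX /= addbb.
have or : odd r by case: (even_prime pr) => // h; rewrite h in r2.
rewrite lognM ?expn_gt0 // lognX (logn_prime r (isT : prime 2)) (negbTE r2) muln0 add0n => lo.
have rk : (r %| k)%N by move: lo; case: (boolP (r %| k)%N) => // h; rewrite lognE (negbTE h) !andbF.
have rM : coprime r M by apply: coprime_dvdl rk kM.
have chir : neg_char e s r = 1.
  have := chisq r; rewrite rM => /eqP; rewrite sqrf_eq1 => /orP[/eqP //|/eqP h].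
  by move: (fodd fk r pr h); rewrite lo.
have [y hy] := legendre_root pr (etrans (legendre_neg_char e1 os pr or rM) chir).
by exists y; move: hy; rewrite opprK -nE.
Qed.

(** For n = 1, 2 modulo 4 the class c = 2 n - 1 works with i = 0.  For n = 3
    modulo 8 every class c = -1 modulo n has character -1, and
    c = (n - 1)/2 works with i = 1. *)
Theorem three_squares_primitive n : (n %% 4 \in [:: 1; 2])%N || (n %% 8 == 3)%N ->
  exists x y z : int, n%:Z = x ^+ 2 + y ^+ 2 + z ^+ 2.
Proof.
move=> H; pose e : nat := ~~ odd n; pose N := if odd n then n else n./2.
have nE : n = (2 ^ e * N)%N.
  rewrite /e /N; case: (boolP (odd n)) => o; first by rewrite mul1n.
  by rewrite expn1 mul2n -{1}(odd_double_half n) (negbTE o).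
have e1 : (e <= 1)%N by apply: leq_b1.
have n4 : (n %% 4 = (n %% 8) %% 4)%N by rewrite modn_dvdm.
have n0 : (0 < n)%N by move: H; case: (n).
have oN : odd N.
  rewrite /N; case: ifP => // o; move: H; rewrite n4.
  have := divn_eq n 8; have := ltn_pmod n (isT : 0 < 8)%N.
  rewrite !inE; lia.
have [s os NE] := odd_prime_list oN; rewrite NE in nE.
have jm1 a : (N %| a.+1)%N -> jacobi s a = sign_mod4 N.
  move=> d; rewrite NE -jacobiN1 //; apply: jacobi_congr => //.
  by rewrite opprK -NE -(addn1 a) in d *.
have [h3|h3] := boolP (n %% 8 == 3)%N.
  have on : odd n by lia.
  have nN : N = n by rewrite /N on.
  apply: (@three_squares_of_character e s n./2 1 n) => //.
  rewrite /neg_char -NE nN {1}/e on expr0 mulr1.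
  have -> : odd n./2 by lia.
  have -> : (1 + n./2 = (n./2).+1./2.*2)%N by lia.
  rewrite -mul2n exprM sign_mod4_sq expr1n mul1r.
  have j2 : jacobi s 2 * jacobi s n./2 = sign_mod4 N.
    rewrite -jacobiM // -(jm1 n.-1) ?nN ?prednK //; congr (jacobi s _); lia.
  have s8 : jacobi s 2 = -1 by rewrite jacobi2 // -NE nN /sign_mod8 (eqP h3).
  have s4 : sign_mod4 N = -1.
    by rewrite /sign_mod4 nN -signr_odd; have -> : odd n./2 by lia.
  by move: j2; rewrite s8 s4; lia.
  have -> : (2 ^ 1 * n./2).+1 = n by lia.
  by [].
have {h3}H : (n %% 4 == 1)%N || (n %% 4 == 2)%N.
  by move: H; rewrite (negbTE h3) orbF !inE.
apply: (@three_squares_of_character e s (2 * n).-1 0 n) => //; last first.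
  by rewrite mul1n prednK ?muln_gt0 // dvdn_mull.
rewrite /neg_char -NE.
have -> : odd (2 * n).-1 by lia.
have jE : jacobi s (2 * n).-1 = sign_mod4 N.
  apply: jm1; rewrite prednK ?muln_gt0 //.
  by rewrite [X in (_ %| 2 * X)%N]nE -NE !dvdn_mull.
rewrite jE; have [on|on] := boolP (odd n).
  rewrite {1}/e on expr0 mulr1 /sign_mod4.
  have -> : N = n by rewrite /N on.
  have -> : (2 * n).-1./2 = n.-1 by lia.
  rewrite -signr_odd; have -> : odd n.-1 = false by lia.
  rewrite expr0 expr1n mul1r -signr_odd; have -> : odd n./2 = false by lia.
  by [].
have s4 : sign_mod4 (2 * n).-1 = -1.
  by rewrite /sign_mod4 -signr_odd; have -> : odd (2 * n).-1./2 by lia.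
have s8 : sign_mod8 (2 * n).-1 = -1.
  by rewrite /sign_mod8; have -> : ((2 * n).-1 %% 8 = 3)%N by lia.
rewrite s4 s8 {1}/e on expr1 exprD /sign_mod4.
by rewrite mulrN1 expr1 mulN1r opprK -expr2 sqrr_sign.
Qed.

(** * From three squares to the theorem *)

Lemma Posz_expn (a k : nat) : (a ^ k)%N%:Z = a%:Z ^+ k.
Proof. by rewrite -!natz natrX. Qed.

Definition representable (m : nat) : Prop :=
  exists x y z w : rat,
    [/\ in_nat_over 27 x, in_nat_over 27 y, in_nat_over 27 z & in_nat_over 27 w] /\
    m%:R = x ^+ 2 + y ^+ 2 + z ^+ 2 + w ^+ 2 /\
    integer_square (x + y + z).

Lemma representable_numerators m t a b c d :
  (a ^ 2 + b ^ 2 + c ^ 2 + d ^ 2 = 729 * m)%N -> (a + b + c = 27 * t ^ 2)%N ->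
  representable m.
Proof.
move=> h2 h1; exists (a%:R / 27%:R), (b%:R / 27%:R), (c%:R / 27%:R), (d%:R / 27%:R).
split; first by split; [exists a | exists b | exists c | exists d].
have n0 : (27%:R : rat) != 0 by rewrite pnatr_eq0.
split.
  have h2R : a%:R ^+ 2 + b%:R ^+ 2 + c%:R ^+ 2 + d%:R ^+ 2 = 729%:R * m%:R :> rat.
    by rewrite -!natrX -!natrD h2 natrM.
  have -> : m%:R = (729%:R * m%:R) / 27%:R ^+ 2 :> rat by field.
  by rewrite -h2R; field.
exists t%:Z; rewrite -!mulrDl -!natrD h1 natrM natrX mulrAC divff // mul1r.
by rewrite rmorphXn /= -pmulrn.
Qed.

(** The numbers x, y, z, w have the numerators s - A + B, s + A - C, s - B + C and
    A + B + C over 3; the three inequalities make them nonnegative. *)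
Lemma representable_three_squares m t A B C :
  (3 * m = t ^ 4 + A ^ 2 + B ^ 2 + C ^ 2)%N ->
  (A <= B + t ^ 2)%N -> (C <= A + t ^ 2)%N -> (B <= C + t ^ 2)%N -> representable m.
Proof.
move=> h; set s := (t ^ 2)%N => AB CA BC.
have t4 : (t ^ 4 = s ^ 2)%N by rewrite /s -expnM.
rewrite t4 in h.
apply: (@representable_numerators m t (9 * (B + s - A)) (9 * (A + s - C))
  (9 * (C + s - B)) (9 * (A + B + C))); last by rewrite -/s; lia.
have [x xE] : exists x, (B + s = x + A)%N by exists (B + s - A)%N; lia.
have [y yE] : exists y, (A + s = y + C)%N by exists (A + s - C)%N; lia.
have [z zE] : exists z, (C + s = z + B)%N by exists (C + s - B)%N; lia.
rewrite xE yE zE !addnK !expnMn -!mulnDr (_ : 729 = 9 ^ 2 * 9)%N // -mulnA; congr muln.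
apply/eqP; rewrite -eqz_nat !(PoszD, PoszM, Posz_expn); apply/eqP.
have -> : x%:Z = B%:Z + s%:Z - A%:Z by lia.
have -> : y%:Z = A%:Z + s%:Z - C%:Z by lia.
have -> : z%:Z = C%:Z + s%:Z - B%:Z by lia.
have hZ : 3 * m%:Z = s%:Z ^+ 2 + A%:Z ^+ 2 + B%:Z ^+ 2 + C%:Z ^+ 2.
  by move/eqP: h; rewrite -eqz_nat !(PoszD, PoszM, Posz_expn) => /eqP.
transitivity (3 * (3 * m%:Z)); last by ring.
by rewrite hZ; ring.
Qed.

Lemma representable16 m : representable m -> representable (16 * m).
Proof.
move=> [x [y [z [w [[hx hy hz hw] [E [t tE]]]]]]].
have four q : in_nat_over 27 q -> in_nat_over 27 (4 * q).
  by move=> [k ->]; exists (4 * k)%N; rewrite natrM mulrA.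
exists (4 * x), (4 * y), (4 * z), (4 * w); split; first by split; apply: four.
split; first by rewrite natrM E; ring.
exists (2 * t); by rewrite -!mulrDr tE; ring.
Qed.

(** The residues modulo 16 that exclude the numbers 4^k (8 l + 7): 7 and 15 are of
    this kind, 12 may be 4 (8 l + 7), and 0 leaves it open. *)
Definition good_residue (r : nat) : bool := r \notin [:: 0; 7; 12; 15]%N.

Lemma three_squares_good_residue n : good_residue (n %% 16) ->
  exists A B C : nat, (n = A ^ 2 + B ^ 2 + C ^ 2)%N.
Proof.
have abs k : (exists x y z : int, k%:Z = x ^+ 2 + y ^+ 2 + z ^+ 2) ->
    exists A B C : nat, (k = A ^ 2 + B ^ 2 + C ^ 2)%N.
  move=> [x [y [z h]]]; exists `|x|%N, `|y|%N, `|z|%N; apply/eqP.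
  by rewrite -eqz_nat h !PoszD !Posz_expn !abszE !real_normK ?num_real.
rewrite /good_residue !inE => g.
have [d4|d4] := boolP (4 %| n)%N.
  have [k nE] := dvdnP d4.
  have [A [B [C kE]]] : exists A B C : nat, (k = A ^ 2 + B ^ 2 + C ^ 2)%N.
    by apply/abs/three_squares_primitive; rewrite !inE; lia.
  by exists (2 * A)%N, (2 * B)%N, (2 * C)%N; rewrite nE kE; ring.
by apply/abs/three_squares_primitive; rewrite !inE; lia.
Qed.

Lemma representable_window m t : (t ^ 4 <= 3 * m)%N -> (3 * m <= 2 * t ^ 4)%N ->
  good_residue ((3 * m - t ^ 4) %% 16) -> representable m.
Proof.
move=> lo hi /three_squares_good_residue[A [B [C E]]].
have le k : (k ^ 2 <= 3 * m - t ^ 4)%N -> (k <= t ^ 2)%N.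
  move=> h; have -> : (k <= t ^ 2)%N = (k ^ 2 <= (t ^ 2) ^ 2)%N by rewrite leq_exp2r.
  rewrite -expnM; lia.
have A1 : (A <= t ^ 2)%N by apply: le; lia.
have B1 : (B <= t ^ 2)%N by apply: le; lia.
have C1 : (C <= t ^ 2)%N by apply: le; lia.
by apply: (@representable_three_squares m t A B C); lia.
Qed.

(** t^4 is 0 or 1 modulo 16, so 3 m - t^4 has residue 3 m or 3 m - 1.  The latter is
    good except for m = 0, 8, 11, 15, and 3 m is good for m = 8, 11, 15.  So the
    parity of t is prescribed, and the t of that parity among the two largest with
    t^4 <= 3 m satisfies 3 m < (t + 2)^4 <= 2 t^4 as soon as t >= 11; this is
    guaranteed by 3 m >= 3 * 6912 = 12^4. *)
Lemma representable_large m : (6912 <= m)%N -> ~~ (16 %| m)%N -> representable m.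
Proof.
move=> m0 m16.
have ex : exists t, (t ^ 4 <= 3 * m)%N by exists 0%N.
have bd t : (t ^ 4 <= 3 * m)%N -> (t <= 3 * m)%N.
  by apply: leq_trans; case: t => // t; rewrite -{1}[t.+1]expn1; apply: leq_pexp2l.
case: (ex_maxnP ex bd) => t tlo tmax.
have thi : (3 * m < (t.+1) ^ 4)%N by rewrite ltnNge; apply/negP => /tmax; rewrite ltnn.
have t12 : (12 <= t)%N by apply: tmax; rewrite (_ : (12 ^ 4 = 3 * 6912)%N) // leq_mul2l.
(* e tells that t has to be even *)
pose e := (m %% 16 \in [:: 8; 11; 15])%N.
pose u := if odd t == ~~ e then t else t.-1.
have ou : odd u = ~~ e.
  rewrite /u; case: ifP => [/eqP //|h].
  have -> : odd t.-1 = ~~ odd t by lia.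
  by move: h; case: (odd t); case: (e).
have ut : (u <= t)%N by rewrite /u; case: ifP => // _; lia.
have tu : (t <= u.+1)%N by rewrite /u; case: ifP => // _; lia.
have ulo : (u ^ 4 <= 3 * m)%N by apply: leq_trans tlo; rewrite leq_exp2r.
apply: (@representable_window m u) => //.
  have h : (3 * m < u.+2 ^ 4)%N by apply: leq_trans thi _; rewrite leq_exp2r.
  have u11 : (11 <= u)%N by lia.
  apply: leq_trans (ltnW h) _; rewrite -(subnKC u11); set v := (u - 11)%N.
  have -> : (2 * (11 + v) ^ 4 =
      (11 + v).+2 ^ 4 + (721 + 1860 * v + 438 * v ^ 2 + 36 * v ^ 3 + v ^ 4))%N.
    by rewrite -addn2; ring.
  exact: leq_addr.
have u16 : (u ^ 4 %% 16 = ~~ e)%N.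
  rewrite -ou -modnXm; have := ltn_pmod u (isT : 0 < 16)%N.
  rewrite -(odd_mod u (erefl : odd 16 = false)).
  by move: (u %% 16)%N => v; do 16?[case: v => [|v] //].
have : (~~ (m %% 16 == 0))%N by [].
rewrite /good_residue !inE; move: u16; rewrite /e !inE.
case: (boolP [|| _, _ | _]) => /= h; lia.
Qed.

(** * Small numbers *)

Local Open Scope N_scope.

(** Conditionals rather than disjunctions, so that call by value evaluation stops
    at the first success. *)
Fixpoint search (fuel : nat) (next : N -> N) (p : N -> bool) (i : N) : bool :=
  if p i then true else
  if fuel is fuel'.+1 then search fuel' next p (next i) else false.

Lemma searchP fuel next p i : search fuel next p i -> exists j, p j.
Proof.
by elim: fuel i => [|f IH] i /=; case: ifP => [pi _|_ //]; [exists i | exists i | exact: IH].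
Qed.

Definition quad (t : N) : N := N.mul (N.mul t t) (N.mul t t).

Definition window_test (m t : N) : bool :=
  let q := quad t in let m3 := N.mul 3 m in
  if N.leb q m3 then
    if N.leb m3 (N.mul 2 q) then
      match N.modulo (N.sub m3 q) 16 with
      | 0 | 7 | 12 | 15 => false
      | _ => true
      end
    else false
  else false.

Definition vector_test (m t A B C : N) : bool :=
  let s := N.mul t t in
  [&& N.eqb (N.mul 3 m) (N.add (N.add (N.add (quad t) (N.mul A A)) (N.mul B B)) (N.mul C C)),
      N.leb A (N.add B s), N.leb C (N.add A s) & N.leb B (N.add C s)].

(** A is the largest of the three squares up to order, hence starts at the square
    root of n/3; small values of A come first because balanced triples are the
    ones likely to satisfy the inequalities.  B decreases from the largest
    possible value to the one where C would exceed A.  The two orders A, B, C and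
    B, A, C are the two cyclic orders.  The residues skipped are those of numbers
    that are no sums of three squares. *)
Definition vector_search (m : N) : bool :=
  search 11 N.pred (fun t =>
    let m3 := N.mul 3 m in let q := quad t in
    if N.leb q m3 then
      let n := N.sub m3 q in
      if N.eqb (N.modulo n 8) 7 then false else
      if N.eqb (N.modulo n 32) 28 then false else
      let L0 := N.sqrt (N.div n 3) in
      search (N.to_nat (N.sub (N.sqrt n) L0)) N.succ (fun A =>
        let r := N.sub n (N.mul A A) in
        let M0 := N.min A (N.sqrt r) in
        let M1 := N.sqrt (N.sub r (N.mul A A)) in
        search (N.to_nat (N.sub M0 M1)) N.pred (fun B =>
          let C := N.sqrt (N.sub r (N.mul B B)) in
          if vector_test m t A B C then true else vector_test m t B A C) M0) L0
    else false) 11.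

(** Multiples of 16 and the numbers in a window are settled by theory; only the
    others are searched.  For m < 6912 the windows are those of t <= 11. *)
Definition small_test (m : N) : bool :=
  if N.eqb (N.modulo m 16) 0 then true else
  if search 10 N.pred (window_test m) 11 then true else
  if vector_search m then true else
  [|| N.eqb m 3, N.eqb m 13 | N.eqb m 21].

Fixpoint test_from (k : nat) (m : N) : bool :=
  if k is k'.+1 then (if small_test m then test_from k' (N.succ m) else false) else true.

Local Close Scope N_scope.

Lemma test_fromP k m0 m : test_from k (N.of_nat m0) -> (m0 <= m < m0 + k)%N ->
  small_test (N.of_nat m).
Proof.
elim: k m0 => [|k IH] m0 /=; first by lia.
case: ifP => // tm rest /andP[lo hi].
have [<-//|ne] := eqVneq m0 m.
by apply: (IH m0.+1); [rewrite Nnat.Nat2N.inj_succ | lia].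
Qed.

Lemma vector_test_sound (m : nat) t A B C : vector_test (N.of_nat m) t A B C -> representable m.
Proof.
rewrite /vector_test /quad => /and4P[/N.eqb_eq h /N.leb_le h1 /N.leb_le h2 /N.leb_le h3].
have sq k : (k ^ 2 = k * k)%N by [].
have fr k : (k ^ 4 = k * k * (k * k))%N by rewrite (expnM k 2 2) !sq.
apply: (@representable_three_squares m (N.to_nat t) (N.to_nat A) (N.to_nat B) (N.to_nat C)).
- by rewrite fr !sq; lia.
- by rewrite sq; lia.
- by rewrite sq; lia.
- by rewrite sq; lia.
Qed.

Lemma to_nat_mod (a b : N) : b <> N.zero ->
  N.to_nat (N.modulo a b) = (N.to_nat a %% N.to_nat b)%N.
Proof.
move=> b0; have lt := N.mod_lt a b b0; have E := N.div_mod a b b0.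
have -> : N.to_nat a = (N.to_nat (N.div a b) * N.to_nat b + N.to_nat (N.modulo a b))%N by lia.
by rewrite modnMDl modn_small //; lia.
Qed.

Lemma window_test_sound (m : nat) t : window_test (N.of_nat m) t -> representable m.
Proof.
rewrite /window_test; set q := quad t.
have qE : (N.to_nat t ^ 4 = N.to_nat q)%N.
  by rewrite (expnM _ 2 2) -!mulnn /q /quad; lia.
case: N.leb_spec0 => // h1; case: N.leb_spec0 => // h2 h3.
apply: (@representable_window m (N.to_nat t)); rewrite qE; clearbody q; try lia.
rewrite /good_residue !inE.
have rE n : (N.to_nat n %% 16)%N = N.to_nat (N.modulo n 16%num) by rewrite to_nat_mod.
have -> : (3 * m - N.to_nat q)%N = N.to_nat (N.sub (N.mul 3%num (N.of_nat m)) q) by lia.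
rewrite rE; move: (N.modulo _ _) h3 => r h3.
have [r0 r7 r12 r15] : [/\ r <> 0%num, r <> 7%num, r <> 12%num & r <> 15%num].
  by split=> rv; move: h3; rewrite rv.
by clear h3; lia.
Qed.

Lemma all_small_tests : test_from 6912 0%num.
Proof. by vm_compute. Qed.

Lemma representable_small m : (m < 6912)%N -> ~~ (16 %| m)%N -> representable m.
Proof.
move=> m1 m16; have := test_fromP (m0 := 0) all_small_tests m1.
rewrite /small_test; case: (N.eqb_spec (N.modulo (N.of_nat m) 16%num) 0%num) => [h|_].
  have mE : (m %% 16)%N = N.to_nat (N.modulo (N.of_nat m) 16%num).
    by rewrite to_nat_mod // Nnat.Nat2N.id.
  by move: m16; rewrite /dvdn mE h.
case: ifP => [/searchP[t /window_test_sound //]|_].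
case: ifP => [/searchP[t]|_]; first cbv beta zeta.
  case: ifP => // _; case: ifP => // _; case: ifP => // _.
  move=> /searchP[A] /searchP[B]; cbv beta zeta.
  by case: ifP => [+ _ _|_ + _]; exact: vector_test_sound.
case/or3P => /N.eqb_eq mE.
- have -> : m = 3%N by lia.
  exact: (@representable_numerators 3 1 7 9 11 44).
- have -> : m = 13%N by lia.
  exact: (@representable_numerators 13 1 6 9 12 96).
have -> : m = 21%N by lia.
exact: (@representable_numerators 21 1 0 8 19 122).
Qed.

Theorem theorem1p3 (m : nat) :
  exists x y z w : rat,
    [/\ in_nat_over 27 x, in_nat_over 27 y, in_nat_over 27 z & in_nat_over 27 w] /\
    m%:R = x ^+ 2 + y ^+ 2 + z ^+ 2 + w ^+ 2 /\
    integer_square (x + y + z).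
Proof.
rewrite -/(representable m); elim/ltn_ind: m => m IH.
have [->|m0] := posnP m; first exact: (@representable_numerators 0 0 0 0 0 0).
have [/dvdnP[k mE]|m16] := boolP (16 %| m)%N.
  by rewrite mE mulnC; apply/representable16/IH; lia.
by have [/representable_small|/representable_large] := ltnP m 6912; apply.
Qed.
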